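(* Let $G:\mathcal S^{\downarrow}\to\mathbb R$ be measurable with $E_P(|G|)<\infty$. For $n\in\mathbb N$ let $E_{\mathbf P(\cdot\mid\pi^n)}(G)$ be the Bayes posterior mean of $G$ at step $n$, i.e. the conditional expectation of $G(S)$ given the random vector $\pi^n$. Then for every $n\in\mathbb N$ $$E_{\mathbf P(\cdot\mid \pi^n)}(G)=E_{\mathbf P}(G(S)\mid \mathcal B_n)\quad \mathbf P\text{-a.s.},$$ and $\left(E_{\mathbf P(\cdot\mid\pi^n)}(G): n\in\mathbb N\right)$ is an integrable $\mathbf P$-martingale with respect to the filtration $(\mathcal B_n:n\in\mathbb N)$. Moreover $$\lim_{n\to\infty}E_{\mathbf P(\cdot\mid\pi^n)}(G)=G(S)\quad \mathbf P\text{-a.s. and in }L^1(\mathbf P),$$ and if $E_P(|G|^p)<\infty$ for some $p>1$, then the limit also holds in $L^p(\mathbf P)$.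
   Context: $\mathbb N=\{1,2,\dots\}$. $\mathcal S^{\downarrow}=\{s=(s(i):i\in\mathbb N): s(i)\ge s(i+1)\ge 0\ \forall i,\ \sum_{i}s(i)=1\}$ is endowed with an arbitrary probability measure $P$, $E_P$ denotes expectation under $P$, and $S\sim P$ is a random element of $\mathcal S^{\downarrow}$. To each $s\in\mathcal S^{\downarrow}$ one associates a collection of disjoint open subintervals $(J^s(i):i\in\mathbb N)$ of $[0,1]$ whose lengths, ranked in decreasing order, are $s$. Let $(X_l:l\ge1)$ be i.i.d. uniform random variables on $[0,1]$, independent of $S$ (individuals). Two individuals are of the same species (class) if they fall in the same interval of $(J^S(i))$; the species are numbered $1,2,\dots$ in order of first appearance. Let $k^n$ be the number of distinct species among $X_1,\dots,X_n$, let $\pi^n(j)$ be the number of individuals among the first $n$ that belong to the $j$-th discovered species, and $\pi^n=(\pi^n(1),\dots,\pi^n(k^n))$. Set $\Pi_n=(\pi^1,\dots,\pi^n)$, $\Pi=(\pi^n:n\in\mathbb N)$, $\mathcal B_n=\sigma(\Pi_n)$. $\mathbf P$ is the joint law of $(S,\Pi)$. *)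

(* Defs.v *)
From HB Require Import structures.
From mathcomp Require Import all_boot all_order all_algebra.
From mathcomp Require Import all_classical all_reals all_analysis.
From mathcomp Require Import measurable_realfun.
Set Implicit Arguments.
Unset Strict Implicit.
Unset Printing Implicit Defensive.
Import Order.TTheory GRing.Theory Num.Theory.
Import numFieldNormedType.Exports.
Local Open Scope classical_set_scope.
Local Open Scope ring_scope.

(* Every family indexed by {1, 2, ...} in the mathematics is indexed by nat
   here, entry i standing for index i + 1: the sequence s, the intervals J, the
   individuals X, the steps pi^n. *)

(* The sigma-algebra generated by the maps Y i, i in D. *)
Definition sigma_of (I T : Type) d (T' : measurableType d) (D : set I)
    (Y : I -> T -> T') : set (set T) :=
  <<s \bigcup_(i in D) preimage_set_system setT (Y i) measurable >>.

Record massPartition (R : realType) := MassPartition {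
  mass :> nat -> R;
  mass_ge0 : forall i, 0 <= mass i;
  mass_nincr : forall i, mass i.+1 <= mass i;
  mass_sum1 : (\sum_(0 <= i <oo) (mass i)%:E = 1)%E }.

Section massPartition_measurable.
Variable R : realType.

Let point_mass (i : nat) : R := (i == 0)%:R.

Let point_mass_ge0 i : 0 <= point_mass i.
Proof. exact: ler0n. Qed.

Let point_mass_nincr i : point_mass i.+1 <= point_mass i.
Proof. by rewrite /point_mass ler_nat. Qed.

Let point_mass_sum1 : (\sum_(0 <= i <oo) (point_mass i)%:E = 1)%E.
Proof.
rewrite (nneseries_split 0 1) => [|k _]; last first.
  by rewrite lee_fin; exact: point_mass_ge0.
by rewrite add0n big_nat1 eseries0 ?adde0// => -[|i].
Qed.

HB.instance Definition _ := gen_eqMixin (massPartition R).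
HB.instance Definition _ := gen_choiceMixin (massPartition R).
HB.instance Definition _ := isPointed.Build (massPartition R)
  (MassPartition point_mass_ge0 point_mass_nincr point_mass_sum1).

(* the trace of the product sigma-algebra *)
Definition mass_measurable : set (set (massPartition R)) :=
  sigma_of setT (fun i (s : massPartition R) => s i).

Let mass_measurableC A : mass_measurable A -> mass_measurable (~` A).
Proof. exact: sigma_algebraC. Qed.

HB.instance Definition _ := @isMeasurable.Build default_measure_display
  (massPartition R) mass_measurable (@sigma_algebra0 _ setT _)
  mass_measurableC (@sigma_algebra_bigcup _ setT _).

End massPartition_measurable.

Definition composition := seq nat.
HB.instance Definition _ := Choice.on composition.
HB.instance Definition _ := isPointed.Build composition [::].
HB.instance Definition _ := @isMeasurable.Build default_measure_display
  composition discrete_measurable discrete_measurable0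
  discrete_measurableC discrete_measurableU.

(* The space in which (pi^n : n) takes its values, with the product
   sigma-algebra. *)
Definition cpath := nat -> composition.
HB.instance Definition _ := Pointed.on cpath.

Definition cpath_measurable : set (set cpath) :=
  sigma_of setT (fun n (y : cpath) => y n).

Lemma cpath_measurableC A : cpath_measurable A -> cpath_measurable (~` A).
Proof. exact: sigma_algebraC. Qed.

HB.instance Definition _ := @isMeasurable.Build default_measure_display
  cpath cpath_measurable (@sigma_algebra0 _ setT _)
  cpath_measurableC (@sigma_algebra_bigcup _ setT _).

(* s is the family l ranked in decreasing order.  A reindexing by a bijection
   of nat would be too strong: if l has infinitely many positive terms, its
   null terms do not appear in s. *)
Definition ranked (R : realType) (l s : nat -> R) : Prop :=
  exists2 f : nat -> nat, injective f &
    (forall i, l (f i) = s i) /\ (forall j, ~ range f j -> l j = 0).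

(* An interval of length 0 is empty.  Joint measurability of the intervals in
   the mass partition and in the point makes the species of an individual a
   random object. *)
Record interval_representation (R : realType)
    (J : massPartition R -> nat -> set R) : Prop := {
  J_open_itv : forall s i, exists a b : R,
    [/\ 0 <= a, a <= b, b <= 1 & J s i = `]a, b[%classic];
  J_disjoint : forall s, trivIset setT (J s);
  J_lengths : forall s, ranked (fun i => fine (lebesgue_measure (J s i))) s;
  J_measurable : forall i,
    measurable [set z : massPartition R * R | J z.1 i z.2] }.

Section species.
Variables (R : realType) (J : nat -> set R) (x : nat -> R).

(* An individual outside all the intervals (a null event) is alone in its
   species. *)
Definition same_species (l m : nat) : bool :=
  (l == m) || `[< exists i, J i (x l) /\ J i (x m) >].

(* The j-th entry is the individual by which the j-th species is discovered,
   among the first n individuals; the length is k^n. *)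
Definition discoverers (n : nat) : seq nat :=
  [seq l <- iota 0 n | ~~ has (same_species l) (iota 0 l)].

Definition species_counts (n : nat) : composition :=
  [seq count (same_species l) (iota 0 n) | l <- discoverers n].

Definition species_path : cpath := fun n => species_counts n.+1.

End species.

Section independence.
Variables (d : measure_display) (T : measurableType d) (R : realType).
Variable Q : probability T R.

Definition independent_RVs d' (T' : measurableType d') (X : nat -> T -> T') :
    Prop :=
  forall (D : seq nat) (B : nat -> set T'), uniq D ->
    (forall l, measurable (B l)) ->
    (Q (\bigcap_(l in [set` D]) X l @^-1` B l)
     = \prod_(l <- D) Q (X l @^-1` B l))%E.

Definition independent_systems (F1 F2 : set (set T)) : Prop :=
  forall A B, F1 A -> F2 B -> (Q (A `&` B) = Q A * Q B)%E.

End independence.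

Section conditional_expectation.
Variables (d : measure_display) (T : measurableType d) (R : realType).
Variable Q : probability T R.

Definition adapted_to (F : set (set T)) (g : T -> R) : Prop :=
  forall B : set R, measurable B -> F (g @^-1` B).

Record is_cond_exp (F : set (set T)) (f g : T -> R) : Prop := {
  cond_exp_adapted : adapted_to F g;
  cond_exp_integrable : Q.-integrable setT (EFin \o g);
  cond_exp_integral : forall A, F A ->
    (\int[Q]_(w in A) (g w)%:E = \int[Q]_(w in A) (f w)%:E)%E }.

(* A version of E_Q(f | F); one exists by [cond_expP]. *)
Definition cond_exp (F : set (set T)) (f : T -> R) : T -> R :=
  xget (cst 0) [set g | is_cond_exp F f g].

Lemma cond_expP (F : set (set T)) (f : T -> R) :
  sigma_algebra setT F -> F `<=` measurable ->
  Q.-integrable setT (EFin \o f) -> is_cond_exp F f (cond_exp F f).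
Proof.
move=> sF Fm intf; rewrite /cond_exp; apply: xgetPex.
have mf := measurable_int _ intf.
have null A : F A -> Q A = 0%E -> (\int[Q]_(w in A) (f w)%:E = 0)%E.
  move=> FA QA0; apply: null_set_integral => //; first exact: Fm.
  exact: measurable_funTS.
pose T' : measurableType _ := g_sigma_algebraType F.
have mT' (A : set T') : measurable A = F A.
  by rewrite -[in RHS](measurable_g_measurableTypeE sF).
pose phi : T -> T' := idfun.
have mphi : measurable_fun setT phi.
  by move=> _ A; rewrite mT' => FA; rewrite setTI; exact: Fm.
pose phim : {mfun T >-> T'} := HB.pack phi (isMeasurableFun.Build _ _ _ _ phi mphi).
pose Q' : probability T' R := distribution Q phim.
pose nu0 : {charge set T' -> \bar R} := pushforward (induced_charge intf) phim.
pose nu := nu0 mphi.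
have nuE A : nu A = (\int[Q]_(w in A) (f w)%:E)%E by [].
have nuQ' : nu `<< Q'.
  by apply/null_content_dominatesP => /= A; rewrite mT' => FA QA0; exact: null.
pose h : T' -> \bar R := Radon_Nikodym nu Q'.
have ih : Q'.-integrable setT h := Radon_Nikodym_integrable nuQ'.
have mh : measurable_fun setT h := measurable_int _ ih.
pose g : T' -> R := fine \o h.
have gE : EFin \o g = h.
  by apply/funext => w /=; rewrite fineK//; exact: Radon_Nikodym_fin_num.
have ihQ : Q.-integrable setT h.
  apply/integrableP; split.
    exact: (measurableT_comp mh mphi).
  move/integrableP: ih => [_].
  rewrite ge0_integral_pushforward//.
  exact: measurableT_comp.
exists g; split.
- move=> B mB; rewrite -mT' -[X in measurable X]setTI.
  suff : measurable_fun setT g by apply.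
  by apply/measurable_EFinP; rewrite gE.
- by rewrite gE.
- move=> A FA; rewrite -nuE (Radon_Nikodym_integral nuQ') ?mT'//.
  rewrite integral_pushforward ?mT'//.
    apply: eq_integral => w _; exact: (congr1 (@^~ w) gE).
  exact: (integrableS measurableT (Fm _ FA)).
Qed.

End conditional_expectation.

Section martingale.
Variables (d : measure_display) (T : measurableType d) (R : realType).
Variable Q : probability T R.

Definition is_filtration (F : nat -> set (set T)) : Prop :=
  [/\ forall n, sigma_algebra setT (F n), forall n, F n `<=` measurable
    & forall m n, (m <= n)%N -> F m `<=` F n].

Record is_martingale (F : nat -> set (set T)) (M : nat -> T -> R) : Prop := {
  martingale_filtration : is_filtration F;
  martingale_adapted : forall n, adapted_to (F n) (M n);
  martingale_integrable : forall n, Q.-integrable setT (EFin \o M n);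
  martingale_cond_exp : forall m n, (m <= n)%N ->
    {ae Q, forall w, cond_exp Q (F m) (M n) w = M m w} }.

Definition cvg_Lp (p : R) (M : nat -> T -> R) (f : T -> R) : Prop :=
  ((fun n => Lnorm Q p%:E (fun w => (M n w - f w)%:E)) @ \oo --> 0)%E.

End martingale.

Section coordinates.
Variable R : realType.

Definition pi_ (n : nat) (z : massPartition R * cpath) : composition := z.2 n.

Definition B_ (n : nat) : set (set (massPartition R * cpath)) :=
  sigma_of [set m | (m <= n)%N] pi_.

Definition posterior_mean (bP : probability (massPartition R * cpath)%type R)
    (G : massPartition R -> R) (n : nat) : massPartition R * cpath -> R :=
  cond_exp bP (g_sigma_algebra_preimage (pi_ n)) (fun z => G z.1).

End coordinates.

(* Main.v *)
Require Import Defs.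
From HB Require Import structures.
From mathcomp Require Import all_boot all_order all_algebra.
From mathcomp Require Import all_classical all_reals all_analysis.
From mathcomp Require Import perm measurable_realfun ring lra.
Set Implicit Arguments.
Unset Strict Implicit.
Unset Printing Implicit Defensive.
Import Order.TTheory GRing.Theory Num.Theory.
Import numFieldNormedType.Exports HBSimple.
Local Open Scope classical_set_scope.
Local Open Scope ring_scope.

(** The theorem rests on two properties of the species sampling scheme.

    Sufficiency [is_cond_exp_B]: the sigma-algebra [B_ n] of the first steps of
    the path carries no more information on [S] than the last of these steps.
    Given [S] the individuals are exchangeable, so a species relation on the
    first [n + 1] individuals and its image under a permutation of them have the
    same joint law with [S] [joint_matrix_event_perm].  Two relations with the
    same species counts, in order of discovery, differ by a permutation
    [species_counts_perm].  Hence the conditional expectation of [G(S)] given the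
    species relation is a function of the counts, and [B_ n] lies between the
    sigma-algebra of the counts and that of the relation.

    Consistency [mass_event_ae]: almost surely, [S] is a function of the whole
    path.  For a fixed mass partition the law of large numbers
    [frequency_cvg_pow2] gives every interval its length as asymptotic frequency
    of visits, so [t < s i] says that at least [i + 1] species have an
    asymptotic frequency above [t] [mass_gt_frequency].  The passage from a fixed
    mass partition to a random one is Fubini's theorem [joint_law].

    By sufficiency the posterior means are the conditional expectations of
    [G(S)] given the filtration, a martingale by the tower property; by
    consistency, Levy's upward theorem gives its almost sure limit.  That
    theorem needs the convergence of closed martingales only, which follows from
    Doob's maximal inequality: the functions for which convergence holds are
    closed under [L^1] limits [levy_cvg_closed] and contain the functions
    measurable at a finite time.  Finally, conditional expectations do not
    increase [L^p] norms [cond_exp_partition_Lp], and almost sure convergence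
    together with this bound gives convergence in [L^p] by Fatou's lemma
    [cvg_Lp_of_ae_cvg]. *)

(** * Conditional expectations *)

Section cond_exp_theory.
Variables (d : measure_display) (T : measurableType d) (R : realType).
Variable Q : probability T R.

(** Viewing a sub-sigma-algebra as the measurable sets of a type gives access
    to the closure properties of measurable sets and functions. *)
Lemma sub_sigma_algebraE (F : set (set T)) : sigma_algebra setT F ->
  F = (measurable : set (set (g_sigma_algebraType F))).
Proof. by move=> sF; rewrite measurable_g_measurableTypeE. Qed.

Lemma adapted_toP (F : set (set T)) (g : T -> R) : sigma_algebra setT F ->
  adapted_to F g <-> measurable_fun [set: g_sigma_algebraType F] g.
Proof.
move=> sF; split=> [Fg _ B mB|mg B mB].
  by rewrite setTI -(sub_sigma_algebraE sF); exact: Fg.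
by rewrite (sub_sigma_algebraE sF) -[X in measurable X]setTI; exact: mg.
Qed.

Lemma integrable_EFinB (f g : T -> R) :
  Q.-integrable setT (EFin \o f) -> Q.-integrable setT (EFin \o g) ->
  Q.-integrable setT (EFin \o (fun w => f w - g w)).
Proof.
move=> If Ig; rewrite (_ : EFin \o _ = (EFin \o f) \- (EFin \o g))%E.
  exact: integrableB.
by apply/funext => w /=; rewrite EFinB.
Qed.

Lemma integrable_EFinZ (c : R) (f : T -> R) :
  Q.-integrable setT (EFin \o f) ->
  Q.-integrable setT (EFin \o (fun w => c * f w)).
Proof.
move=> If; rewrite (_ : EFin \o _ = (fun w => c%:E * (EFin \o f) w)%E).
  exact: integrableZl.
by apply/funext => w /=; rewrite EFinM.
Qed.

Lemma integrable_measurable (f : T -> R) :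
  Q.-integrable setT (EFin \o f) -> measurable_fun setT f.
Proof. by move=> /measurable_int/measurable_EFinP. Qed.

Lemma integral_indic_diff (A B : set T) : measurable A -> measurable B ->
  B `<=` A -> (\int[Q]_w `|(\1_A w - \1_B w)%R|%:E = Q (A `\` B))%E.
Proof.
move=> mA mB BA; rewrite -(setIT (A `\` B)) -integral_indic//.
  apply: eq_integral => w _; congr EFin; rewrite !indicE in_setD.
  case: (boolP (w \in B)) => /= [/set_mem/BA/mem_set ->|_].
    by rewrite subrr normr0.
  by rewrite subr0 andbT normr_nat.
exact: measurableD.
Qed.

Section sub_sigma_algebra.
Variable F : set (set T).
Hypotheses (sF : sigma_algebra setT F) (Fm : F `<=` measurable).

Let FE := sub_sigma_algebraE sF.

Lemma is_cond_exp_id (f : T -> R) : adapted_to F f ->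
  Q.-integrable setT (EFin \o f) -> is_cond_exp Q F f f.
Proof. by move=> Ff If; split. Qed.

Lemma is_cond_expB (f f' g g' : T -> R) :
  Q.-integrable setT (EFin \o f) -> Q.-integrable setT (EFin \o f') ->
  is_cond_exp Q F f g -> is_cond_exp Q F f' g' ->
  is_cond_exp Q F (fun w => f w - f' w) (fun w => g w - g' w).
Proof.
move=> If If' [Fg Ig gE] [Fg' Ig' g'E]; split.
- apply/(adapted_toP _ sF); apply: measurable_funB; exact/adapted_toP.
- exact: integrable_EFinB.
- move=> A FA; have mA := Fm FA.
  under eq_integral do rewrite EFinB.
  under [RHS]eq_integral do rewrite EFinB.
  by rewrite !integralB_EFin// ?gE ?g'E//; apply: (integrableS measurableT).
Qed.

Lemma is_cond_expZ (c : R) (f g : T -> R) :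
  Q.-integrable setT (EFin \o f) -> is_cond_exp Q F f g ->
  is_cond_exp Q F (fun w => c * f w) (fun w => c * g w).
Proof.
move=> If [Fg Ig gE]; split.
- apply/(adapted_toP _ sF); apply: measurable_funM => //; exact/adapted_toP.
- exact: integrable_EFinZ.
- move=> A FA; have mA := Fm FA.
  under eq_integral do rewrite EFinM.
  under [RHS]eq_integral do rewrite EFinM.
  by rewrite !integralZl// ?gE//; apply: (integrableS measurableT).
Qed.

(** The sign of [g] is an event of [F]: cutting [A] along it turns [`|g|] into
    [g] or [- g], whose integrals are those of [f] or [- f]. *)
Lemma is_cond_exp_contraction (f g : T -> R) (A : set T) :
  Q.-integrable setT (EFin \o f) -> is_cond_exp Q F f g -> F A ->
  (\int[Q]_(w in A) `|g w|%:E <= \int[Q]_(w in A) `|f w|%:E)%E.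
Proof.
move=> If [Fg Ig gE] FA; have mA := Fm FA.
pose B := [set w | 0 <= g w].
have FB : F B.
  have := Fg _ (measurable_itv `[0, +oo[).
  by congr F; apply/seteqP; split=> w /=; rewrite in_itv/= ?andbT.
have FAB : F (A `&` B) by move: FA FB; rewrite FE; exact: measurableI.
have FAC : F (A `&` ~` B).
  by move: FA FB; rewrite FE => FA FB; apply: measurableI => //; exact:
    measurableC.
have mAB := Fm FAB; have mAC := Fm FAC.
have disj : [disjoint A `&` B & A `&` ~` B].
  by apply/disj_setPS => w [[_ ?] [_]].
have AE : A = (A `&` B) `|` (A `&` ~` B) by rewrite -setIUr setUv setIT.
have mn (h : T -> R) D : Q.-integrable setT (EFin \o h) ->
    measurable_fun D (fun w => `|h w|%:E).
  move=> Ih; apply: measurable_funTS.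
  by apply/measurable_EFinP/measurableT_comp => //; exact:
    integrable_measurable.
rewrite AE !ge0_integral_setU//; [|exact: mn|exact: mn].
have IfS D : measurable D -> Q.-integrable D (EFin \o f).
  by move=> mD; exact: (integrableS measurableT).
have InS D : measurable D -> Q.-integrable D (fun w => `|f w|%:E).
  by move=> mD; apply: integrable_norm; exact: IfS.
apply: leeD.
- rewrite (eq_integral (fun w => (g w)%:E)) => [|w]; last first.
    by rewrite inE => -[_ Bw]; rewrite ger0_norm.
  rewrite gE//; apply: le_integral => //; [exact: IfS|exact: InS|].
  by move=> w _; rewrite lee_fin ler_norm.
- rewrite (eq_integral (fun w => - (g w)%:E)%E) => [|w]; last first.
    by rewrite inE => -[_ /negP]; rewrite -ltNge => /ltW Bw; rewrite ler0_norm.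
  rewrite integralN; last first.
    by apply: integrable_add_def => //; exact: (integrableS measurableT).
  rewrite gE// -integralN; last exact/integrable_add_def/IfS.
  apply: le_integral => //; [exact/integrableN/IfS|exact: InS|].
  by move=> w _; rewrite -EFinN lee_fin -normrN ler_norm.
Qed.

(** The difference of two versions is a version of [E(0 | F)], so contraction
    makes it null. *)
Lemma is_cond_exp_unique (f g g' : T -> R) :
  Q.-integrable setT (EFin \o f) ->
  is_cond_exp Q F f g -> is_cond_exp Q F f g' -> {ae Q, forall w, g w = g' w}.
Proof.
move=> If Hg Hg'; have H := is_cond_expB If If Hg Hg'.
have Id : Q.-integrable setT (EFin \o (fun w => g w - g' w)).
  exact: cond_exp_integrable H.
have FT : F setT by rewrite FE; exact: measurableT.
have := is_cond_exp_contraction (integrable_EFinB If If) H FT.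
under [leRHS]eq_integral do rewrite subrr normr0.
rewrite integral0 => le0.
have /ae_eq_integral_abs : (\int[Q]_w `|(g w - g' w)%:E| = 0)%E.
  by apply/eqP; rewrite eq_le le0 integral_ge0.
move=> /(_ measurableT (measurable_int _ Id)).
by apply: filterS => w /(_ I) /= [] /eqP; rewrite subr_eq0 => /eqP.
Qed.

End sub_sigma_algebra.

Lemma is_cond_exp_tower (F F' : set (set T)) (f g g' : T -> R) : F `<=` F' ->
  is_cond_exp Q F' f g' -> is_cond_exp Q F f g -> is_cond_exp Q F g' g.
Proof.
move=> FF' [Fg' Ig' g'E] [Fg Ig gE]; split=> // A FA.
by rewrite gE// g'E//; exact: FF'.
Qed.

End cond_exp_theory.

(** * Convergence along a filtration *)

Lemma measurable_norm_ge d (T : measurableType d) (R : realType) (u : T -> R)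
  (a : R) : measurable_fun setT u -> measurable [set w | a <= `|u w|].
Proof.
move=> mu; have mnu : measurable_fun setT (fun w => `|u w|).
  exact: measurableT_comp.
rewrite -[X in measurable X]setTI.
have := mnu measurableT _ (measurable_itv `[a, +oo[).
by congr measurable; apply/seteqP; split=> w /=; rewrite in_itv/= ?andbT.
Qed.

Lemma ae_cvg_of_lim_sup_set d (T : measurableType d) (R : realType)
  (Q : probability T R) (u : nat -> T -> R) (f : T -> R) :
  (forall n, measurable_fun setT (u n)) -> measurable_fun setT f ->
  (forall a, 0 < a ->
     Q (lim_sup_set (fun n => [set w | a <= `|u n w - f w|])) = 0%E) ->
  {ae Q, forall w, u n w @[n --> \oo] --> f w}.
Proof.
move=> mu mf far0; pose far (a : R) n := [set w | a <= `|u n w - f w|].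
have mlim a : measurable (lim_sup_set (far a)).
  apply: bigcap_measurable => // k _; apply: bigcup_measurable => n _.
  by apply: measurable_norm_ge; exact: measurable_funB.
exists (\bigcup_k lim_sup_set (far k.+1%:R^-1)); split.
- exact: bigcup_measurable.
- apply/eqP; rewrite eq_le measure_ge0 andbT.
  have := measure_sigma_subadditive Q (fun k => mlim k.+1%:R^-1)
    (bigcup_measurable (fun k _ => mlim k.+1%:R^-1)) (@subset_refl _ _).
  move=> /le_trans; apply; rewrite eseries0// => k _ _.
  by rewrite /= -/(far _) far0.
- move=> w; apply: contra_notP => nfar; apply/cvgrPdist_lt => e e0.
  pose k := Num.truncn e^-1.
  have ke : k.+1%:R^-1 < e.
    rewrite invf_plt ?posrE//; exact: truncnS_gt.
  have /existsNP[m /not_implyP[_ nm]] : ~ lim_sup_set (far k.+1%:R^-1) w.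
    by move=> ?; apply: nfar; exists k.
  near=> n; rewrite distrC; apply: lt_trans ke; rewrite ltNge; apply/negP =>
    farn.
  by apply: nm; exists n => //=; near: n; exists m.
Unshelve. all: by end_near. Qed.

Section levy_upward.
Variables (d : measure_display) (T : measurableType d) (R : realType).
Variable Q : probability T R.
Variable F : nat -> set (set T).
Hypothesis filF : is_filtration F.

Let sF n : sigma_algebra setT (F n). Proof. by case: filF. Qed.
Let Fm n : F n `<=` measurable. Proof. by case: filF. Qed.
Let Fle m n : (m <= n)%N -> F m `<=` F n. Proof. by case: filF => _ _;
  exact. Qed.

(** Doob's inequality: on the event that [n] is the first index with
    [a <= `|g n|], which lies in [F n], contraction gives
    [a <= `|h|] in mean; these events are disjoint. *)
Lemma maximal_inequality (h : T -> R) (g : nat -> T -> R) (a : R) : 0 < a ->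
  Q.-integrable setT (EFin \o h) -> (forall n, is_cond_exp Q (F n) h (g n)) ->
  (a%:E * Q (\bigcup_n [set w | (a <= `|g n w|)%R]) <= \int[Q]_w `|h w|%:E)%E.
Proof.
move=> a0 Ih Hg; pose E n := [set w | a <= `|g n w|].
have mabs : measurable_fun setT (fun w => `|h w|%:E).
  by apply/measurable_EFinP/measurableT_comp => //; exact:
    (integrable_measurable Ih).
have FE n : F n (E n).
  have := proj1 (adapted_toP _ (sF n)) (cond_exp_adapted (Hg n)).
  by move=> /(measurable_norm_ge a); rewrite -(sub_sigma_algebraE (sF n)).
have FD n : F n (seqDU E n).
  rewrite (sub_sigma_algebraE (sF n)) /seqDU; apply: measurableD.
    by rewrite -(sub_sigma_algebraE (sF n)); exact: FE.
  apply: bigsetU_measurable => k _; rewrite -(sub_sigma_algebraE (sF n)).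
  exact: (Fle (ltnW (ltn_ord k))).
have mD n : measurable (seqDU E n) by exact: Fm.
rewrite -/E seqDU_bigcup_eq measure_bigcup//.
rewrite -nneseriesZl//.
apply: (@le_trans _ _ (\sum_(n <oo) \int[Q]_(w in seqDU E n) `|h w|%:E)%E).
  rewrite (eq_eseriesl _ (Q := xpredT)) => [|k]; last exact: in_setT.
  apply: lee_nneseries => [k _ _|k _].
    by apply: mule_ge0 => //; rewrite lee_fin ltW.
  apply: le_trans (is_cond_exp_contraction (sF k) (Fm (n :=
    k)) Ih (Hg k) (FD k)).
  rewrite -integral_cst//; apply: ge0_le_integral => //.
  - by move=> w _ /=; rewrite lee_fin ltW.
  - apply/measurable_funTS/measurable_EFinP/measurableT_comp => //.
    exact: (integrable_measurable (cond_exp_integrable (Hg k))).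
  - by move=> w [] Ew _; rewrite lee_fin.
rewrite -ge0_integral_bigcup//; last exact: measurable_funTS.
apply: ge0_subset_integral => //; exact: bigcup_measurable.
Qed.

(** Quantifying over all versions spares every closure property below the
    choice of a version. *)
Definition levy_cvg (f : T -> R) : Prop :=
  forall g : nat -> T -> R, (forall n, is_cond_exp Q (F n) f (g n)) ->
    {ae Q, forall w, g n w @[n --> \oo] --> f w}.

Lemma levy_cvg_adapted (m : nat) (f : T -> R) : adapted_to (F m) f ->
  Q.-integrable setT (EFin \o f) -> levy_cvg f.
Proof.
move=> Ff If g Hg.
have gf n : {ae Q, forall w, g (m + n)%N w = f w}.
  apply: (is_cond_exp_unique (sF _) (Fm (n := _)) If (Hg _)).
  apply: is_cond_exp_id => // B /Ff; apply: Fle; exact: leq_addr.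
have /ae_foralln := gf; apply: filterS => w gfw.
apply: cvg_near_cst; near=> n.
have mn : (m <= n)%N by near: n; exists m.
by rewrite -(subnKC mn) gfw.
Unshelve. all: by end_near. Qed.

Lemma levy_cvgB (f f' : T -> R) :
  Q.-integrable setT (EFin \o f) -> Q.-integrable setT (EFin \o f') ->
  levy_cvg f -> levy_cvg f' -> levy_cvg (fun w => f w - f' w).
Proof.
move=> If If' Lf Lf' g Hg.
pose h n := cond_exp Q (F n) f'.
have Hh n : is_cond_exp Q (F n) f' (h n) by exact: cond_expP.
have Ih' := integrable_EFinZ (-1) If'.
have Hgh n : is_cond_exp Q (F n) f (fun w => g n w - -1 * h n w).
  have := is_cond_expB (sF n) (Fm (n := n)) (integrable_EFinB If If') Ih'
    (Hg n) (is_cond_expZ (sF n) (Fm (n := n)) (-1) If' (Hh n)).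
  by congr is_cond_exp; apply/funext => w; rewrite mulN1r opprK subrK.
apply: filterS2 (Lf _ Hgh) (Lf' _ Hh) => w fw f'w.
have -> : (fun n => g n w) = (fun n => (g n w - -1 * h n w) - h n w).
  by apply/funext => n; rewrite mulN1r opprK addrK.
exact: cvgB.
Qed.

Lemma levy_cvgZ (c : R) (f : T -> R) :
  Q.-integrable setT (EFin \o f) -> levy_cvg f -> levy_cvg (fun w => c * f w).
Proof.
move=> If Lf g Hg.
pose h n := cond_exp Q (F n) f.
have Hh n : is_cond_exp Q (F n) f (h n) by exact: cond_expP.
have Ic := integrable_EFinZ c If.
have /ae_foralln gh n : {ae Q, forall w, g n w = c * h n w}.
  apply: (is_cond_exp_unique (sF n) (Fm (n := n)) Ic (Hg n)).
  exact: is_cond_expZ.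
apply: filterS2 gh (Lf _ Hh) => w gw fw.
by under eq_fun do rewrite gw; exact: cvgMr.
Qed.

(** Let [h n] be the conditional expectations of an approximation [f'].  If
    [`|g n - f|] exceeds [a] infinitely often, then [`|g n - h n|] for some [n]
    or [`|f - f'|] exceeds [a / 3], since [h n] tends to [f'].  Both events have
    probability at most [3 / a] times the norm of [f - f'], the first one by the
    maximal inequality. *)
Lemma levy_cvg_closed (f : T -> R) : Q.-integrable setT (EFin \o f) ->
  (forall e, 0 < e -> exists f', [/\ Q.-integrable setT (EFin \o f'),
     levy_cvg f' & (\int[Q]_w `|(f w - f' w)%R|%:E <= e%:E)%E]) ->
  levy_cvg f.
Proof.
move=> If Af g Hg.
have mf := integrable_measurable If.
have mg n : measurable_fun setT (g n).
  exact: (integrable_measurable (cond_exp_integrable (Hg n))).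
pose far (a : R) n := [set w | a <= `|g n w - f w|].
have mfar a n : measurable (far a n) by apply: measurable_norm_ge; exact:
  measurable_funB.
have mlim a : measurable (lim_sup_set (far a)).
  by apply: bigcap_measurable => // k _; exact: bigcup_measurable.
have far0 (a : R) : 0 < a -> Q (lim_sup_set (far a)) = 0%E.
  move=> a0; apply/eqP; rewrite eq_le measure_ge0 andbT.
  apply/lee_addgt0Pr => e e0; rewrite add0e.
  pose b := a / 3.
  have b0 : 0 < b by rewrite divr_gt0.
  (* At this precision each of the two events has probability at most
     [e / 2]. *)
  have [f' [If' Lf' ff']] := Af (b * (e / 2)) ltac:(by rewrite mulr_gt0 //
    divr_gt0).
  pose h n := cond_exp Q (F n) f'.
  have Hh n : is_cond_exp Q (F n) f' (h n) by exact: cond_expP.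
  have Hgh n := is_cond_expB (sF n) (Fm (n := n)) If If' (Hg n) (Hh n).
  have [N [mN N0 hN]] := Lf' _ Hh.
  pose A := \bigcup_n [set w | b <= `|g n w - h n w|].
  pose B := [set w | b <= `|f w - f' w|].
  have mf' := integrable_measurable If'.
  have mh n : measurable_fun setT (h n).
    exact: (integrable_measurable (cond_exp_integrable (Hh n))).
  have mA : measurable A.
    by apply: bigcup_measurable => n _; apply: measurable_norm_ge; exact:
      measurable_funB.
  have mB : measurable B by apply: measurable_norm_ge; exact: measurable_funB.
  have QA : (Q A <= (e / 2)%:E)%E.
    have := maximal_inequality b0 (integrable_EFinB If If') Hgh.
    move=> /le_trans /(_ ff').
    by rewrite (EFinM b (e / 2)) lee_pmul2l.
  have QB : (Q B <= (e / 2)%:E)%E.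
    have mff' : measurable_fun setT (EFin \o (fun w => f w - f' w)).
      by apply/measurable_EFinP; exact: measurable_funB.
    have := le_integral_abse Q measurableT mff' b0.
    rewrite setTI => /le_trans /(_ ff').
    by rewrite (EFinM b (e / 2)) lee_pmul2l.
  apply: (@le_trans _ _ (Q (N `|` (A `|` B)))).
    apply: le_measure; rewrite ?inE//.
      by apply: measurableU => //; exact: measurableU.
    move=> w farw; apply: contrapT => /not_orP[Nw /not_orP[Aw Bw]].
    have hw : h n w @[n --> \oo] --> f' w by apply: contrapT => /hN.
    have [m _ hm] : \forall n \near \oo, `|f' w - h n w| < b.
      by move/cvgrPdist_lt : hw; exact.
    have [n /= mn] := farw m I.
    rewrite /far /= leNgt => /negP; apply.
    have -> : g n w - f w = (g n w - h n w) + (h n w - f' w) + (f' w - f w).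
      by ring.
    rewrite (le_lt_trans (ler_normD _ _))// (_ : a = b + b + b); last first.
      by rewrite /b; field.
    rewrite ltrD//; last first.
      by rewrite distrC ltNge; apply/negP => ?; exact: Bw.
    rewrite (le_lt_trans (ler_normD _ _))// ltrD//.
      by rewrite ltNge; apply/negP => ?; apply: Aw; exists n.
    by rewrite distrC; exact: hm.
  apply: (le_trans (measureU2 _ _ _)) => //; first exact: measurableU.
  rewrite -[X in (X <= _)%E]/(Q N + Q (A `|` B))%E.
  rewrite [X in (X + _)%E](N0 : Q N = 0%E) add0e.
  apply: (le_trans (measureU2 _ _ _)) => //.
  by rewrite (splitr e) EFinD leeD.
exact: ae_cvg_of_lim_sup_set.
Qed.

(** The events with this property form a lambda-system, by
    [levy_cvg_closed], and it contains the pi-system of the events of the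
    filtration. *)
Lemma levy_cvg_indic (A : set T) : <<s \bigcup_n F n >> A -> levy_cvg (\1_A).
Proof.
pose H := [set B | measurable B /\ levy_cvg (\1_B)].
have Iind (B : set T) : measurable B -> Q.-integrable setT (EFin \o \1_B).
  exact: integrable_indic.
have FI n B : F n B -> H B.
  move=> FB; have mB := Fm FB; split=> //; apply: (levy_cvg_adapted (m := n)).
    apply/(adapted_toP _ (sF n)); apply: measurable_indic.
    by rewrite -(sub_sigma_algebraE (sF n)).
  exact: Iind.
have FI2 : setI_closed (\bigcup_n F n).
  move=> B C [m _ mB] [n _ nC]; exists (maxn m n) => //.
  have := Fle (leq_maxl m n) mB; have := Fle (leq_maxr m n) nC.
  by rewrite (sub_sigma_algebraE (sF _)) => mC' mB'; exact: measurableI.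
have LH : lambda_system setT H.
  split.
  - by [].
  - apply: (FI 0%N); rewrite (sub_sigma_algebraE (sF _)); exact: measurableT.
  - move=> B C CB [mB LB] [mC LC]; split; first exact: measurableD.
    have := levy_cvgB (Iind _ mB) (Iind _ mC) LB LC.
    congr levy_cvg; apply/funext => w; rewrite !indicE in_setD.
    case: (boolP (w \in C)) => [/set_mem/CB/mem_set ->|_].
      by rewrite subrr.
    by rewrite subr0 andbT.
  - move=> B ndB HB; have mB n : measurable (B n) by have [] := HB n.
    have mU : measurable (\bigcup_n B n) by exact: bigcup_measurable.
    split=> //; apply: levy_cvg_closed; first exact: Iind.
    move=> e e0; have := nondecreasing_cvg_mu (mu := Q) mB mU ndB.
    rewrite -[X in _ --> X](fineK (fin_num_measure Q _ mU)).
    move=> /fine_cvgP[_ /cvgrPdist_le/(_ e e0)[n _ /(_ n (leqnn n)) /=]] Qe.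
    have Qn : (Q (\bigcup_n B n) - Q (B n) <= e%:E)%E.
      rewrite -(fineK (fin_num_measure Q _ mU)) -(fineK (fin_num_measure Q _
        (mB n))).
      by rewrite -EFinB lee_fin (le_trans (ler_norm _)).
    exists (\1_(B n)); split; [exact: Iind|by have [] := HB n|].
    have BU : B n `<=` \bigcup_n B n by exact: bigcup_sup.
    rewrite integral_indic_diff// measureD//; last first.
      by rewrite ltey_eq fin_num_measure.
    by rewrite setIidr.
have : <<s \bigcup_n F n >> `<=` H.
  by apply: lambda_system_subset => // B [n _]; exact: FI.
by move=> /[apply] -[].
Qed.

End levy_upward.

Section levy_simple.
Variables (R : realType) (d : measure_display) (T : measurableType d).
Variables (Q : probability T R) (F : nat -> set (set T)).
Hypothesis filF : is_filtration F.

Lemma levy_cvg_sum (I : Type) (s : seq I) (c : I -> R) (f : I -> T -> R) :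
  (forall i, Q.-integrable setT (EFin \o f i)) ->
  (forall i, levy_cvg Q F (f i)) ->
  Q.-integrable setT (EFin \o (fun w => \sum_(i <- s) c i * f i w)) /\
  levy_cvg Q F (fun w => \sum_(i <- s) c i * f i w).
Proof.
move=> If Lf; elim: s => [|i s [Is Ls]].
  have E0 : (fun w => \sum_(i <- [::]) c i * f i w) = cst 0.
    by apply/funext => w; rewrite big_nil.
  have I0 : Q.-integrable setT (EFin \o cst 0) by exact:
    finite_measure_integrable_cst.
  rewrite E0; split => //; apply: (levy_cvg_adapted filF (m := 0%N)) => //.
  have [sF _ _] := filF; exact/(adapted_toP _ (sF 0%N))/measurable_cst.
have E : (fun w => \sum_(j <- i :: s) c j * f j w) =
    (fun w => c i * f i w - -1 * \sum_(j <- s) c j * f j w).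
  by apply/funext => w; rewrite big_cons mulN1r opprK.
rewrite E; split; first by apply: integrable_EFinB; exact: integrable_EFinZ.
apply: levy_cvgB => //; [exact: integrable_EFinZ|exact: integrable_EFinZ| |].
  exact: levy_cvgZ.
exact: levy_cvgZ.
Qed.

End levy_simple.

(** * Convergence in mean of order p *)

Section Lp.
Variable R : realType.

Lemma le_limn_einf (u v : nat -> \bar R) : (forall n, (u n <= v n)%E) ->
  (limn_einf u <= limn_einf v)%E.
Proof.
move=> uv; rewrite !limn_einf_lim; apply: lee_lim; try exact: is_cvg_einfs.
apply: nearW => n; apply: le_ereal_inf_tmp => _ [k /= nk <-].
by apply: le_trans (uv k); apply: ereal_inf_lbound; exists k.
Qed.

Lemma powR_norm_cvg0 (p : R) (u : nat -> R) : 0 < p ->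
  u n @[n --> \oo] --> 0 -> `|u n| `^ p @[n --> \oo] --> 0.
Proof.
move=> p0 /cvgr0Pnorm_lt u0; apply/cvgr0Pnorm_lt => e e0.
have := u0 (e `^ p^-1); rewrite powR_gt0// => /(_ isT).
apply: filterS => n un; rewrite ger0_norm ?powR_ge0//.
have <- : (e `^ p^-1) `^ p = e.
  by rewrite -powRrM mulVf ?gt_eqF// powRr1// ltW.
by apply: gt0_ltr_powR => //; rewrite nnegrE ?powR_ge0.
Qed.

Lemma powR_norm_cvg (p : R) (u : nat -> R) (l : R) : 0 < p ->
  u n @[n --> \oo] --> l -> `|u n| `^ p @[n --> \oo] --> `|l| `^ p.
Proof.
move=> p0; have [-> u0|l0 ul] := eqVneq l 0.
  by rewrite normr0 powR0 ?gt_eqF//; exact: powR_norm_cvg0.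
have al0 : 0 < `|l| by rewrite normr_gt0.
apply: (@cvg_comp _ _ _ (fun n => `|u n|) (fun x : R => x `^ p) _ (nbhs `|l|)).
  exact: cvg_norm.
have /derivable1_diffP/differentiable_continuous : derivable (fun x : R =>
  x `^ p) `|l| 1.
  by apply: derivable_powR; rewrite in_itv/= andbT.
exact.
Qed.

Lemma powR_normD_le (p x y : R) : 0 <= p ->
  `|x - y| `^ p <= 2 `^ p * (`|x| `^ p + `|y| `^ p).
Proof.
move=> p0; rewrite mulrDr -!powRM//.
wlog xy : x y / `|x| <= `|y| => [H|].
  have [/H//|/ltW/H h] := leP `|x| `|y|.
  by rewrite distrC [leRHS]addrC.
apply: (@le_trans _ _ ((2 * `|y|) `^ p)); last by rewrite lerDr powR_ge0.
apply: ge0_ler_powR => //; rewrite ?nnegrE ?mulr_ge0//.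
by rewrite (le_trans (ler_normB _ _))// mulr_natl mulr2n lerD2r.
Qed.

(** The tangent of [x `^ p] at [m] lies below its graph, by Young's
    inequality. *)
Lemma powR_tangent_le (p m u : R) : 1 <= p -> 0 <= m -> 0 <= u ->
  p * m `^ (p - 1) * u <= u `^ p + (p - 1) * m `^ p.
Proof.
rewrite le_eqVlt => /predU1P[<- m0 u0|p1 m0 u0].
  by rewrite subrr powRr0 !mul1r mul0r addr0 powRr1.
have p0 : 0 < p by rewrite (lt_trans ltr01).
have q0 : 0 < p - 1 by rewrite subr_gt0.
have pq : p^-1 + (p / (p - 1))^-1 = 1.
  by rewrite invf_div -{1}[p^-1]mul1r -mulrDl addrC subrK divff// gt_eqF.
have := @conjugate_powR _ u (m `^ (p - 1)) p (p / (p - 1)) u0 (powR_ge0 _ _)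
  p0 (divr_gt0 p0 q0) pq.
rewrite -powRrM (_ : (p - 1) * (p / (p - 1)) = p); last first.
  by field; rewrite gt_eqF.
rewrite -(ler_pM2l p0) mulrDr.
rewrite (_ : p * (u `^ p / p) = u `^ p); last by field; rewrite gt_eqF.
rewrite (_ : p * (m `^ p / _) = (p - 1) * m `^ p); last first.
  by field; rewrite !gt_eqF.
by rewrite [u * _]mulrC mulrA.
Qed.

Variables (d : measure_display) (T : measurableType d) (Q : probability T R).

Lemma measurable_norm_powR (p : R) (f : T -> R) D : measurable_fun setT f ->
  measurable_fun D (fun w => (`|f w| `^ p)%:E).
Proof.
move=> mf; apply/measurable_funTS/measurable_EFinP.
by apply: (measurableT_comp (measurable_powR p)); exact: measurableT_comp.
Qed.

(** On a piece of the partition the conditional expectation is the mean there,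
    so the inequality is Jensen's for that mean. *)
Lemma cond_exp_partition_Lp (F : set (set T)) (D : nat -> set T) (f g : T -> R)
  (p : R) : 1 <= p -> sigma_algebra setT F -> F `<=` measurable ->
  (forall k, F (D k)) -> trivIset setT D -> \bigcup_k D k = setT ->
  (forall k w w', D k w -> D k w' -> g w = g w') ->
  Q.-integrable setT (EFin \o f) -> is_cond_exp Q F f g ->
  (\int[Q]_w (`|g w| `^ p)%:E <= \int[Q]_w (`|f w| `^ p)%:E)%E.
Proof.
move=> p1 sF Fm FD tD UD gD If Hg.
have mf := integrable_measurable If.
have mg := integrable_measurable (cond_exp_integrable Hg).
have mD k : measurable (D k) by exact: Fm.
have splitE (u : T -> R) : measurable_fun setT u ->
    (\int[Q]_w (`|u w| `^ p)%:E = \sum_(k <oo) \int[Q]_(w in D k) (`|u w| `^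
      p)%:E)%E.
  move=> mu; rewrite -[X in integral _ X _]UD; apply: ge0_integral_bigcup => //.
    exact: measurable_norm_powR.
rewrite (splitE g mg) (splitE f mf).
apply: lee_nneseries => [k _ _|k _].
  by apply: integral_ge0 => w _; rewrite lee_fin powR_ge0.
have [->|/set0P[w0 Dw0]] := eqVneq (D k) set0; first by rewrite !integral_set0.
pose m := `|g w0|.
have gm w : w \in D k -> `|g w| = m by move=> /set_mem Dw;
  rewrite (gD _ _ _ Dw Dw0).
have QDf := fin_num_measure Q _ (mD k).
have -> : (\int[Q]_(w in D k) (`|g w| `^ p)%:E = (m `^ p)%:E * Q (D k))%E.
  rewrite -(integral_cst Q (mD k)); apply: eq_integral => w /gm /= -> //.
have := is_cond_exp_contraction sF Fm If Hg (FD k).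
have -> : (\int[Q]_(w in D k) `|g w|%:E = m%:E * Q (D k))%E.
  rewrite -(integral_cst Q (mD k)); apply: eq_integral => w /gm /= -> //.
move=> mQ.
have mfn : measurable_fun (D k) (fun w => `|f w|%:E).
  by apply/measurable_funTS/measurable_EFinP; exact: measurableT_comp.
have p10 : 0 <= p - 1 by rewrite subr_ge0.
have m0 : 0 <= m by exact: normr_ge0.
have tangent : ((p * m `^ (p - 1))%:E * \int[Q]_(w in D k) `|f w|%:E <=
    \int[Q]_(w in D k) (`|f w| `^ p)%:E + ((p - 1) * m `^ p)%:E * Q (D k))%E.
  rewrite -integral_cst// -ge0_integralD//; last 2 first.
  - exact: measurable_norm_powR.
  - by move=> w _ /=; rewrite lee_fin mulr_ge0// powR_ge0.
  rewrite -ge0_integralZl_EFin//;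
    last by rewrite mulr_ge0 ?powR_ge0// ltW// (lt_le_trans ltr01).
  apply: ge0_le_integral => //.
  - by move=> w _; rewrite lee_fin !mulr_ge0 ?powR_ge0// ltW// (lt_le_trans
    ltr01).
  - exact: measurable_funeM.
  - apply: emeasurable_funD => //; exact: measurable_norm_powR.
  - by move=> w _; rewrite -EFinM -EFinD lee_fin powR_tangent_le.
rewrite -(leeD2rE (x := ((p - 1) * m `^ p)%:E * Q (D k))); last first.
  by rewrite fin_numM.
apply: le_trans tangent.
apply: (@le_trans _ _ ((p * m `^ (p - 1))%:E * (m%:E * Q (D k)))%E); last first.
  by rewrite lee_wpmul2l// lee_fin mulr_ge0 ?powR_ge0// (le_trans ler01).
rewrite muleA -EFinM -mulrA [_ * m]mulrC mulr_powRB1//; last first.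
  by rewrite (lt_le_trans ltr01).
rewrite -ge0_muleDl ?lee_fin ?mulr_ge0 ?powR_ge0//.
by rewrite -EFinD mulrBl mul1r addrC subrK.
Qed.

(** Almost sure convergence with norms bounded by that of the limit: Fatou's
    lemma for the nonnegative functions
    [2 `^ p * (`|M n| `^ p + `|f| `^ p) - `|M n - f| `^ p], whose integrals are
    at most [2 * 2 `^ p * \int `|f| `^ p] minus the one to be bounded. *)
Lemma cvg_Lp_of_ae_cvg (p : R) (M : nat -> T -> R) (f : T -> R) : 0 < p ->
  (forall n, measurable_fun setT (M n)) -> measurable_fun setT f ->
  {ae Q, forall w, M n w @[n --> \oo] --> f w} ->
  (\int[Q]_w (`|f w| `^ p)%:E < +oo)%E ->
  (forall n, \int[Q]_w (`|M n w| `^ p)%:E <= \int[Q]_w (`|f w| `^ p)%:E)%E ->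
  cvg_Lp Q p M f.
Proof.
move=> p0 mM mf Mf If IM.
pose c := 2 `^ p; have c0 : 0 <= c by exact: powR_ge0.
pose b n := (\int[Q]_w (`|M n w - f w| `^ p)%:E)%E.
pose I0 := (\int[Q]_w (`|f w| `^ p)%:E)%E.
have I0f : I0 \is a fin_num by rewrite ge0_fin_numE// integral_ge0// => w _;
  rewrite lee_fin powR_ge0.
pose h n w := (c * (`|M n w| `^ p + `|f w| `^ p) - `|M n w - f w| `^ p).
have h0 n w : 0 <= h n w by rewrite subr_ge0; exact: powR_normD_le (ltW p0).
have mpow (u : T -> R) : measurable_fun setT u ->
    measurable_fun setT (fun w => `|u w| `^ p).
  by move=> mu; apply/measurable_EFinP; exact: measurable_norm_powR.
have mMf n : measurable_fun setT (fun w => M n w - f w) by exact: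
  measurable_funB.
have mh n : measurable_fun setT (fun w => (h n w)%:E).
  apply/measurable_EFinP; apply: measurable_funB; last exact: mpow.
  by apply: measurable_funM => //; apply: measurable_funD; exact: mpow.
have I2 n : (\int[Q]_w (h n w)%:E + b n <= (c + c)%:E * I0)%E.
  rewrite /b -ge0_integralD//; last 2 first.
  - by move=> w _; rewrite lee_fin.
  - exact: measurable_norm_powR.
  under eq_integral do rewrite -EFinD subrK EFinM EFinD.
  rewrite ge0_integralZl_EFin//; last 2 first.
  - by move=> w _; rewrite -EFinD lee_fin addr_ge0// powR_ge0.
  - by apply: emeasurable_funD; exact: measurable_norm_powR.
  rewrite ge0_integralD//; last 2 first.
  - exact: measurable_norm_powR.
  - exact: measurable_norm_powR.
  rewrite EFinD ge0_muleDl ?lee_fin// -/I0 ge0_muleDr.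
  - apply: leeD; last exact: lexx.
    by apply: lee_wpmul2l; [rewrite lee_fin|exact: IM].
  - by apply: integral_ge0 => w _; rewrite lee_fin powR_ge0.
  - by apply: integral_ge0 => w _; rewrite lee_fin powR_ge0.
have b0 n : (0 <= b n)%E by apply: integral_ge0 => w _;
  rewrite lee_fin powR_ge0.
have bf n : b n \is a fin_num.
  rewrite (ge0_fin_numE (b0 n)); apply: (@le_lt_trans _ _ ((c + c)%:E * I0)%E).
    by apply: le_trans (I2 n); rewrite leeDr// integral_ge0// => w _;
      rewrite lee_fin.
  by rewrite ltey_eq fin_numM.
have Fh := @fatou _ _ _ Q setT measurableT (fun n w => (h n w)%:E) mh
  (fun n w _ => (h0 n w : (0 <= (h n w)%:E)%E)).
have LHS : (\int[Q]_w limn_einf (fun n => (h n w)%:E) = (c + c)%:E * I0)%E.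
  rewrite /I0 -ge0_integralZl_EFin//; last 2 first.
  - exact: measurable_norm_powR.
  - by rewrite addr_ge0.
  apply: ae_eq_integral => //.
  - apply: measurableT_comp => //; apply: measurable_fun_limn_esup => n.
    by apply: measurableT_comp => //; exact: mh.
  - by apply: measurable_funeM; exact: measurable_norm_powR.
  - apply: filterS Mf => w Mfw _.
    have : (h n w)%:E @[n --> \oo] --> ((c + c)%:E * (`|f w| `^ p)%:E)%E.
      rewrite -EFinM; apply: cvg_EFin; first by near=> n.
      rewrite (_ : (c + c) * _ = c * (`|f w| `^ p + `|f w| `^ p) - 0);
        last by ring.
      apply: cvgB.
        apply: cvgMr; apply: cvgD; last exact: cvg_cst.
        exact: powR_norm_cvg.
      by apply: powR_norm_cvg0 => //; rewrite -(subrr (f w)); apply: cvgB =>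
        //; exact: cvg_cst.
    by move=> /cvg_limn_einf_sup[].
have bcvg : b n @[n --> \oo] --> 0%E.
  apply: limn_esup_le_cvg => //.
  have Kf : ((c + c)%:E * I0)%E \is a fin_num by rewrite fin_numM.
  have : ((c + c)%:E * I0 <= limn_einf (fun n => (c + c)%:E * I0 + - b n))%E.
    rewrite -{1}LHS; apply: (le_trans Fh); apply: le_limn_einf => n.
    by rewrite (leeBrDr _ _ (bf n)); exact: I2.
  rewrite limn_einf_shift// -[X in (X <= _)%E]adde0 leeD2lE// limn_einfN.
  by rewrite leeNr oppe0.
have LnormE n : Lnorm Q p%:E (fun w => (M n w - f w)%:E) =
    (`|fine (b n)| `^ p^-1)%:E.
  rewrite unlock (ger0_norm (fine_ge0 (b0 n))) -poweR_EFin (fineK (bf n)).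
  by congr poweR; apply: eq_integral => w _ /=; rewrite poweR_EFin.
rewrite /cvg_Lp; under eq_fun do rewrite LnormE.
apply: cvg_EFin; first exact: nearW.
apply: powR_norm_cvg0; first by rewrite invr_gt0.
by have /fine_cvgP[] := bcvg.
Unshelve. all: by end_near. Qed.

End Lp.

(** * A law of large numbers for events *)

Section law_of_large_numbers.
Variables (R : realType) (d : measure_display) (T : measurableType d).
Variables (Q : probability T R) (A : nat -> set T) (a : R).
Hypotheses (mA : forall m, measurable (A m)) (QA : forall m, Q (A m) = a%:E).
Hypothesis QAA : forall m k, m != k -> Q (A m `&` A k) = (a * a)%:E.

Let Z m (w : T) : R := \1_(A m) w - a.
Let W N (w : T) : R := \sum_(m < N) Z m w.

Let mZ m : measurable_fun setT (Z m).
Proof. by apply: measurable_funB => //; exact: measurable_indic. Qed.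

Let mW N : measurable_fun setT (W N).
Proof. exact: measurable_sum. Qed.

Let a01 : 0 <= a <= 1.
Proof.
by rewrite -!lee_fin -(QA 0%N) measure_ge0 probability_le1.
Qed.

Let Z_le1 m w : `|Z m w| <= 1.
Proof.
have /andP[a0 a1] := a01; rewrite /Z indicE; case: (w \in A m) => /=.
  by rewrite ger0_norm ?subr_ge0// gerBl.
by rewrite sub0r normrN ger0_norm.
Qed.

Let IZZ m k : Q.-integrable setT (EFin \o (fun w => Z m w * Z k w)).
Proof.
apply: measurable_bounded_integrable => //.
- by rewrite (le_lt_trans (probability_le1 _ _))// ltry.
- exact: measurable_funM.
- exists 1; split=> // M M1 w _ /=; rewrite normrM (le_trans _ (ltW M1))//.
  by rewrite mulr_ile1.
Qed.

(* Off the diagonal, pairwise independence makes the mean vanish. *)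
Let EZZ m k : (\int[Q]_w (Z m w * Z k w)%:E <= (m == k)%:R%:E)%E.
Proof.
have [<-|mk] := eqVneq m k.
  apply: (@le_trans _ _ (\int[Q]_w (cst 1%E w))%E).
    apply: le_integral => //; first exact: IZZ.
      exact: finite_measure_integrable_cst.
    move=> w _; rewrite lee_fin (le_trans (ler_norm _))// normrM mulr_ile1//.
  by rewrite integral_cst// mul1e probability_le1.
have ZE w : Z m w * Z k w =
    \1_(A m `&` A k) w - a * \1_(A m) w - a * \1_(A k) w + a * a.
  by rewrite /Z indicI /=; ring.
have Ii B : measurable B -> Q.-integrable setT (EFin \o \1_B).
  exact: integrable_indic.
have Iai B : measurable B -> Q.-integrable setT (EFin \o (fun w => a * \1_B w)).
  move=> mB; rewrite (_ : EFin \o _ = (fun w => a%:E * (EFin \o \1_B) w)%E).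
    exact/integrableZl/Ii.
  by apply/funext => w /=; rewrite EFinM.
have EB B : measurable B -> (\int[Q]_w (a * \1_B w)%:E = a%:E * Q B)%E.
  move=> mB; under eq_integral do rewrite EFinM.
  by rewrite integralZl ?integral_indic ?setIT//; exact: Ii.
have mI : measurable (A m `&` A k) by exact: measurableI.
have I1 := integrable_EFinB (Ii _ mI) (Iai _ (mA m)).
have I2 := integrable_EFinB I1 (Iai _ (mA k)).
under eq_integral do rewrite ZE EFinD EFinB.
rewrite integralD_EFin//; last exact: finite_measure_integrable_cst.
rewrite integralB_EFin//; last exact: Iai.
under eq_integral do rewrite EFinB.
rewrite integralB_EFin//; [|exact: Ii|exact: Iai].
have EI : (\int[Q]_w (\1_(A m `&` A k) w)%:E = (a * a)%:E)%E.
  by rewrite integral_indic// setIT; exact: QAA.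
have EC : (\int[Q]_w (a * a)%:E = (a * a)%:E)%E.
  rewrite integral_cst// -[RHS]mule1; congr (_ * _)%E; exact: probability_setT.
rewrite EI !EB// EC !QA -!EFinM -!EFinB -EFinD lee_fin.
by rewrite subrr sub0r addNr.
Qed.

Let EW2 N : (\int[Q]_w (W N w ^+ 2)%:E <= N%:R%:E)%E.
Proof.
have WE w : (W N w ^+ 2)%:E =
    (\sum_(p <- enum {: 'I_N * 'I_N}) (Z p.1 w * Z p.2 w)%:E)%E.
  by rewrite big_enum /= expr2 /W big_distrlr /= pair_big /= sumEFin.
under eq_integral do rewrite WE.
rewrite integral_sum//; last by move=> p; exact: (IZZ p.1 p.2).
apply: (@le_trans _ _ (\sum_(p <- enum {: 'I_N * 'I_N}) (p.1 == p.2)%:R%:E)%E).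
  by apply: lee_sum => p _; exact: EZZ.
rewrite big_enum /= sumEFin lee_fin.
rewrite -(pair_big xpredT xpredT (fun i j : 'I_N => (i == j)%:R)) /=.
under eq_bigr => i _.
  rewrite (bigD1 i)//= eqxx big1 => [|j ji]; last by rewrite eq_sym (negbTE ji).
  rewrite addr0; over.
by rewrite sumr_const card_ord.
Qed.

(** The frequency among [N] trials has variance at most [N^-1], which is
    summable along the powers of two: Chebyshev's inequality and the
    Borel-Cantelli lemma conclude.  The subsequence suffices to identify
    asymptotic frequencies, and it spares a fourth moment. *)
Lemma frequency_cvg_pow2 :
  {ae Q, forall w, (\sum_(m < 2 ^ r) \1_(A m) w) / (2 ^ r)%:R @[r --> \oo] -->
    a}.
Proof.
apply: (@ae_cvg_of_lim_sup_set _ _ _ _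
  (fun r w => (\sum_(m < 2 ^ r) \1_(A m) w) / (2 ^ r)%:R) (cst a)) => //.
  move=> r; apply: measurable_funM => //; apply: measurable_sum => m.
  exact: measurable_indic.
move=> e e0; have WE r w : (\sum_(m < 2 ^ r) \1_(A m) w) / (2 ^ r)%:R - a =
    W (2 ^ r) w / (2 ^ r)%:R.
  rewrite /W /Z big_split /= sumr_const card_ord mulrDl mulNrn -[a *+
    _]mulr_natr mulNr.
  by rewrite mulfK // pnatr_eq0 expn_eq0.
apply: lim_sup_set_cvg0 => [r|].
  apply: measurable_norm_ge; apply: measurable_funB => //.
  apply: measurable_funM => //; apply: measurable_sum => m; exact:
    measurable_indic.
apply: (@le_lt_trans _ _ (\sum_(r <oo) ((2 / e ^+ 2) / (2 ^ r.+1)%:R)%:E)%E);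
  last first.
  rewrite (le_lt_trans (epsilon_trick0 _ _)) ?ltry//.
  by rewrite divr_ge0// sqr_ge0.
apply: lee_nneseries => [//|r _].
have N0 : 0 < (2 ^ r)%:R :> R by rewrite ltr0n expn_gt0.
(* Chebyshev's inequality for the square of the centred count. *)
pose c := (e * (2 ^ r)%:R) ^+ 2.
have c0 : 0 < c by rewrite exprn_gt0// mulr_gt0.
have mW2 : measurable_fun setT (fun w => (W (2 ^ r) w ^+ 2)%:E).
  by apply/measurable_EFinP; exact: measurable_funX.
have := le_integral_abse Q measurableT mW2 c0; rewrite setTI.
under eq_integral do rewrite gee0_abs ?lee_fin ?sqr_ge0//.
move=> /le_trans /(_ (EW2 _)) cheb.
have -> : ((2 / e ^+ 2) / (2 ^ r.+1)%:R)%:E = (c^-1%:E * (2 ^ r)%:R%:E)%E.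
  rewrite -EFinM /c expnS natrM; congr EFin; field.
  by rewrite !gt_eqF.
rewrite -(@lee_pmul2l _ c%:E)// ?lte_fin//.
have -> : (c%:E * (c^-1%:E * (2 ^ r)%:R%:E) = (2 ^ r)%:R%:E)%E.
  by rewrite -!EFinM mulrA divff ?mul1r// gt_eqF.
apply: le_trans cheb; rewrite lee_pmul2l ?lte_fin//.
have mfar : measurable [set w | e <= `|(\sum_(m < 2 ^ r) \1_(A m) w) / (2 ^
  r)%:R - a|].
  apply: measurable_norm_ge; apply: measurable_funB => //.
  apply: measurable_funM => //; apply: measurable_sum => m; exact:
    measurable_indic.
apply: le_measure; rewrite ?inE//.
  exact: (measurable_norm_ge c (proj1 (measurable_EFinP _ _) mW2)).
move=> w /=; rewrite WE => ew.
rewrite lee_fin ger0_norm ?sqr_ge0// -[leRHS]real_normK ?num_real//.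
rewrite lerXn2r ?nnegrE ?mulr_ge0 ?normr_ge0 ?ler0n ?(ltW e0)//.
by move: ew; rewrite normrM normfV (gtr0_norm N0) ler_pdivlMr.
Qed.



End law_of_large_numbers.

(** * Species relations and species counts *)

Section species_combinatorics.
Variables (R : realType) (J : nat -> set R) (x : nat -> R).
Hypothesis tJ : trivIset setT J.

Let same := same_species J x.

Lemma same_speciesxx l : same l l.
Proof. by rewrite /same /same_species eqxx. Qed.

Lemma same_species_sym l m : same l m = same m l.
Proof.
rewrite /same /same_species eq_sym; congr (_ || _).
by apply: asbool_equiv_eq; split=> -[i [? ?]]; exists i.
Qed.

Lemma same_species_trans m l k : same l m -> same m k -> same l k.
Proof.
rewrite /same /same_species => /orP[/eqP-> //|/asboolP[i [Jl Jm]]].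
move=> /orP[/eqP<-|/asboolP[j [Jm' Jk]]].
  by apply/orP; right; apply/asboolP; exists i.
have ij : i = j by apply: (tJ I I); exists (x m).
by apply/orP; right; apply/asboolP; exists i; split=> //; rewrite ij.
Qed.

Lemma same_species_eql l m : same l m -> same l =1 same m.
Proof.
move=> lm k; apply/idP/idP; apply: same_species_trans => //.
by rewrite same_species_sym.
Qed.

Lemma mem_discoverers n l : (l \in discoverers J x n) =
  (l < n)%N && ~~ has (same l) (iota 0 l).
Proof. by rewrite mem_filter mem_iota add0n andbC. Qed.

Lemma discoverers_uniq n : uniq (discoverers J x n).
Proof. exact/filter_uniq/iota_uniq. Qed.

Lemma discoverers_same n l m : l \in discoverers J x n ->
  m \in discoverers J x n -> same l m -> l = m.
Proof.
rewrite !mem_discoverers => /andP[_ /hasPn hl] /andP[_ /hasPn hm] lm.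
apply/eqP; case: ltngtP => // [lt_lm|lt_ml].
- by have := hm l; rewrite mem_iota add0n lt_lm same_species_sym lm => /(_ isT).
- by have := hl m; rewrite mem_iota add0n lt_ml lm => /(_ isT).
Qed.

Lemma has_discoverer n l : (l < n)%N -> has (same l) (discoverers J x n).
Proof.
move=> ln; have ex : exists m, same l m by exists l; exact: same_speciesxx.
case: (ex_minnP ex) => m lm mmin; apply/hasP; exists m => //.
have ml : (m <= l)%N by apply: mmin; exact: same_speciesxx.
rewrite mem_discoverers (leq_ltn_trans ml ln)/=; apply/hasPn => k.
rewrite mem_iota add0n => /= km; apply/negP => mk.
by have := mmin _ (same_species_trans lm mk); rewrite leqNgt km.
Qed.

Definition species_label n l := find (same l) (discoverers J x n).

Lemma species_label_lt n l : (l < n)%N ->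
  (species_label n l < size (discoverers J x n))%N.
Proof. by move=> /has_discoverer; rewrite has_find. Qed.

Lemma species_labelE n l j : (l < n)%N -> (j < size (discoverers J x n))%N ->
  (species_label n l == j) = same (nth 0%N (discoverers J x n) j) l.
Proof.
move=> ln jD; have h := has_discoverer ln.
have s := nth_find 0%N h; rewrite -/(species_label n l) in s.
apply/eqP/idP => [<-|jl]; first by rewrite same_species_sym.
apply/eqP; rewrite -(nth_uniq 0%N _ jD (discoverers_uniq n))
  ?species_label_lt//.
apply/eqP; apply: (@discoverers_same n); rewrite ?mem_nth ?species_label_lt//.
by rewrite same_species_sym; apply: same_species_trans s.
Qed.

Lemma species_label_eq n l m : (l < n)%N -> (m < n)%N ->
  (species_label n l == species_label n m) = same l m.
Proof.
move=> ln mn; rewrite species_labelE ?species_label_lt//.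
have s := nth_find 0%N (has_discoverer mn); rewrite -/(species_label n m) in s.
by rewrite -(same_species_eql s) same_species_sym.
Qed.

Lemma count_species_label n j :
  count_mem j (map (species_label n) (iota 0 n)) = nth 0%N (species_counts J x
    n) j.
Proof.
rewrite count_map; have [jD|Dj] := ltnP j (size (discoverers J x n)).
  rewrite (nth_map 0%N)//; apply: eq_in_count => l; rewrite mem_iota add0n =>
    ln /=.
  by rewrite species_labelE.
rewrite nth_default ?size_map//; apply/eqP; rewrite eqn0Ngt -has_count.
apply/hasPn => l; rewrite mem_iota add0n => ln /=.
by rewrite neq_ltn (leq_trans _ Dj)// species_label_lt.
Qed.

Lemma discoverersS n : discoverers J x n.+1 =
  discoverers J x n ++ (if has (same n) (iota 0 n) then [::] else [:: n]).
Proof.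
by rewrite /discoverers -addn1 iotaD filter_cat /= add0n -/same; case: has.
Qed.

End species_combinatorics.

(** The species labels of the first [n] individuals form two words with the
    same number of occurrences of each letter, hence one is a rearrangement of
    the other. *)
Lemma species_counts_perm (R : realType) (J J' : nat -> set R) (x x' : nat -> R)
    (n : nat) : trivIset setT J -> trivIset setT J' ->
  species_counts J x n = species_counts J' x' n ->
  exists p : 'S_n, forall l m : 'I_n,
    same_species J' x' l m = same_species J x (p l) (p m).
Proof.
move=> tJ tJ' eqc.
pose t := [tuple species_label J x n i | i < n].
pose t' := [tuple species_label J' x' n i | i < n].
have val_tab (f : nat -> nat) :
  [tuple f i | i < n] = map f (iota 0 n) :> seq nat.
  by rewrite -val_enum_ord -map_comp.
have /tuple_permP[p tE] : perm_eq t' t.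
  rewrite !val_tab; apply/allP => j _ /=.
  by rewrite !count_species_label// eqc.
have tnthE i : tnth t' i = tnth t (p i).
  have -> : t' = [tuple tnth t (p i) | i < n] by exact: val_inj.
  by rewrite tnth_mktuple.
exists p => l m; rewrite -(species_label_eq x' tJ' (ltn_ord l) (ltn_ord m))
  -(species_label_eq x tJ (ltn_ord (p l)) (ltn_ord (p m))).
by have := tnthE l; have := tnthE m; rewrite !tnth_mktuple => -> ->.
Qed.

Lemma eq_species_counts (R : realType) (J J' : nat -> set R) (x x' : nat -> R)
    (n : nat) :
  (forall l m, (l < n)%N -> (m < n)%N ->
     same_species J x l m = same_species J' x' l m) ->
  species_counts J x n = species_counts J' x' n.
Proof.
move=> eqs; have eqD : discoverers J x n = discoverers J' x' n.
  apply: eq_in_filter => l; rewrite mem_iota add0n => ln; congr negb.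
  apply: eq_in_has => m; rewrite mem_iota add0n => ml.
  by rewrite eqs// (ltn_trans ml).
rewrite /species_counts eqD; apply/eq_in_map => l.
rewrite mem_filter mem_iota add0n => /andP[_ ln].
by apply: eq_in_count => m; rewrite mem_iota add0n => mn; rewrite eqs.
Qed.

(** * Masses as asymptotic frequencies *)

Section discovery.
Variables (R : realType) (J : nat -> set R) (x : nat -> R).
Hypothesis tJ : trivIset setT J.

Lemma discoverers_prefix n n' : (n <= n')%N ->
  prefix (discoverers J x n) (discoverers J x n').
Proof.
move=> /subnKC <-; elim: (n' - n)%N => [|k ih];
  first by rewrite addn0 prefix_refl.
by rewrite addnS discoverersS; apply: prefix_trans ih (prefix_prefix _ _).
Qed.

Lemma nth_discoverers n n' j : (n <= n')%N -> (j < size (discoverers J x n))%N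
  ->
  (j < size (discoverers J x n'))%N /\
  nth 0%N (discoverers J x n') j = nth 0%N (discoverers J x n) j.
Proof.
move=> /discoverers_prefix /prefixP[e ->] jn.
by rewrite size_cat nth_cat jn ltn_addr.
Qed.

Lemma same_species_in_interval i l m : J i (x l) ->
  same_species J x l m = `[< J i (x m) >].
Proof.
move=> Jl; apply/orP/asboolP => [[/eqP <- //|/asboolP[k [Jkl Jkm]]]|Jm].
  by rewrite (_ : i = k)//; apply: (tJ I I); exists (x l).
by right; apply/asboolP; exists i.
Qed.

Lemma interval_discovered i m : J i (x m) ->
  exists j, (j < size (discoverers J x m.+1))%N /\
            J i (x (nth 0%N (discoverers J x m.+1) j)).
Proof.
move=> Jm; exists (species_label J x m.+1 m); split.
  exact: species_label_lt.
have := nth_find 0%N (has_discoverer x tJ (ltnSn m)).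
by rewrite (same_species_in_interval _ Jm) => /asboolP.
Qed.

Lemma nth_species_counts_interval i j n n' : (n <= n')%N ->
  (j < size (discoverers J x n))%N -> J i (x (nth 0%N (discoverers J x n) j)) ->
  nth 0%N (species_counts J x n') j = (\sum_(m < n') `[< J i (x m) >])%N.
Proof.
move=> nn' jn Jj; have [jn' E] := nth_discoverers nn' jn.
rewrite (nth_map 0%N)// E -sum1_count big_mkcond /=.
rewrite -[n' in iota 0 n']subn0 -/(index_iota 0 n') big_mkord.
apply: eq_bigr => m _; rewrite (same_species_in_interval _ Jj).
by case: asboolP.
Qed.

Lemma nth_species_counts_isolated j n n' : (n <= n')%N ->
  (j < size (discoverers J x n))%N ->
  (forall i, ~ J i (x (nth 0%N (discoverers J x n) j))) ->
  (nth 0%N (species_counts J x n') j <= 1)%N.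
Proof.
move=> nn' jn Jj; have [jn' E] := nth_discoverers nn' jn.
rewrite (nth_map 0%N)// E.
set l := nth _ _ _; rewrite (@eq_count _ _ (pred1 l)) => [|m].
  by rewrite count_uniq_mem ?iota_uniq// leq_b1.
rewrite /= /same_species eq_sym orb_idr// => /asboolP[i [Jil _]].
by have := Jj i Jil.
Qed.

Variable s : massPartition R.
Hypothesis rJ : ranked (fun i => fine (lebesgue_measure (J i))) s.
Hypothesis freq : forall i,
  (\sum_(m < 2 ^ r) `[< J i (x m) >])%N%:R / (2 ^ r)%:R @[r --> \oo] -->
  fine (lebesgue_measure (J i)).

(** Step [(2 ^ r).-1] of a path describes the first [2 ^ r] individuals. *)
Definition species_frequency (y : cpath) (j : nat) : \bar R :=
  limn_esup (fun r => ((nth 0%N (y (2 ^ r).-1) j)%:R / (2 ^ r)%:R)%:E).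

Let y := species_path J x.

Let yE r : y (2 ^ r).-1 = species_counts J x (2 ^ r).
Proof. by rewrite /y /species_path prednK// expn_gt0. Qed.

Let big_pow n : \forall r \near \oo, (n <= 2 ^ r)%N.
Proof. by exists n => // r /= nr; rewrite (leq_trans nr)// ltnW// ltn_expl. Qed.

Lemma species_frequency_interval i j n : (j < size (discoverers J x n))%N ->
  J i (x (nth 0%N (discoverers J x n) j)) ->
  species_frequency y j = (fine (lebesgue_measure (J i)))%:E.
Proof.
move=> jn Jj.
suff h : ((nth 0%N (y (2 ^ r).-1) j)%:R / (2 ^ r)%:R)%:E @[r --> \oo] -->
    (fine (lebesgue_measure (J i)))%:E.
  by rewrite /species_frequency (cvg_limn_einf_sup h).2.
apply: cvg_EFin; first exact: nearW.
apply: (cvg_trans _ (@freq i)); apply: near_eq_cvg.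
near=> r; have nr : (n <= 2 ^ r)%N by near: r; exact: big_pow.
by rewrite /= yE (nth_species_counts_interval nr jn Jj).
Unshelve. all: by end_near. Qed.

Lemma species_frequency_isolated j :
  (forall n i, (j < size (discoverers J x n))%N ->
     ~ J i (x (nth 0%N (discoverers J x n) j))) ->
  species_frequency y j = 0%E.
Proof.
move=> nJ.
suff h : ((nth 0%N (y (2 ^ r).-1) j)%:R / (2 ^ r)%:R)%:E @[r --> \oo] --> (0 :
  R)%:E.
  by rewrite /species_frequency (cvg_limn_einf_sup h).2.
apply: cvg_EFin; first exact: nearW.
have le1 n : (nth 0%N (species_counts J x n) j <= 1)%N.
  have [jn|nj] := ltnP j (size (discoverers J x n)).
    by apply: (nth_species_counts_isolated (leqnn n)) => // i; exact: nJ.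
  by rewrite nth_default// size_map.
apply: (@squeeze_cvgr _ _ _ _ (cst 0) (fun r => (1 / 2 : R) ^+ r)).
- near=> r; rewrite /= divr_ge0//= expr_div_n expr1n natrX.
  by rewrite ler_pM2r ?invr_gt0 ?exprn_gt0// yE -[1]/(1%:R) ler_nat.
- exact: cvg_cst.
- apply: cvg_expr; rewrite ger0_norm//; lra.
Unshelve. all: by end_near. Qed.

(** [s i > t] says that at least [i + 1] intervals are longer than [t], that
    is, that at least [i + 1] species have an asymptotic frequency above [t]:
    under [freq] an interval of positive length is visited, so it belongs to a
    discovered species, and an individual outside the intervals forms a species
    of frequency 0.  The bound [0 <= t] discards the latter. *)
Lemma mass_gt_frequency (t : R) i : 0 <= t ->
  t < s i <-> exists js : seq nat, [/\ size js = i.+1, uniq js &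
    forall j, j \in js -> (t%:E < species_frequency y j)%E].
Proof.
move=> t0; have [f finj [fs f0]] := rJ.
have sdecr k k' : (k <= k')%N -> s k' <= s k.
  move=> /subnKC <-; elim: (k' - k)%N => [|e ih]; first by rewrite addn0.
  by rewrite addnS; exact: le_trans (mass_nincr s _) ih.
split=> [tsi|[js [szjs ujs js_gt]]].
- have visited k : (k <= i)%N -> exists nj : nat * nat,
      (nj.2 < size (discoverers J x nj.1))%N /\
      J (f k) (x (nth 0%N (discoverers J x nj.1) nj.2)).
    move=> ki; have sk0 : 0 < s k by rewrite (le_lt_trans t0)// (lt_le_trans
      tsi)// sdecr.
    have := @freq (f k); rewrite fs =>
      /cvgrPdist_lt /(_ _ sk0)[r _ /(_ r (leqnn r)) /= hr].
    have [m Jm] : exists m, J (f k) (x m).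
      apply: contrapT => /forallNP nJm; move: hr.
      rewrite big1 => [|m _]; last by case: asboolP => // /nJm.
      by rewrite mul0r subr0 ger0_norm ?ltxx// ltW.
    by have [j [? ?]] := interval_discovered Jm; exists (m.+1, j).
  have [g gP] : {g : nat -> nat * nat & forall k, (k <= i)%N ->
      ((g k).2 < size (discoverers J x (g k).1))%N /\
      J (f k) (x (nth 0%N (discoverers J x (g k).1) (g k).2))}.
    apply: (@choice _ _ (fun k nj => (k <= i)%N
      -> (nj.2 < size (discoverers J x nj.1))%N /\
      J (f k) (x (nth 0%N (discoverers J x nj.1) nj.2)))) => k.
    have [/visited[nj h]|] := leqP k i; first by exists nj.
    by exists (0, 0)%N.
  exists [seq (g k).2 | k <- iota 0 i.+1]; split.
  + by rewrite size_map size_iota.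
  + rewrite map_inj_in_uniq ?iota_uniq// => k k'.
    rewrite !mem_iota !add0n !ltnS => /gP[ks kJ] /gP[ks' kJ'] eqj.
    apply: finj; apply: (tJ I I).
    exists (x (nth 0%N (discoverers J x (maxn (g k).1 (g k').1)) (g k).2)).
    have [_ E] := nth_discoverers (leq_maxl (g k).1 (g k').1) ks.
    have [_ E'] := nth_discoverers (leq_maxr (g k).1 (g k').1) ks'.
    by split; [rewrite E|rewrite eqj E'].
  + move=> _ /mapP[k + ->]; rewrite mem_iota add0n ltnS => ki.
    have [ks kJ] := gP k ki.
    by rewrite (species_frequency_interval ks kJ) fs lte_fin (lt_le_trans
      tsi)// sdecr.
- have rank j : j \in js -> exists kn : nat * nat, [/\ t < s kn.1,
      (j < size (discoverers J x kn.2))%N &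
      J (f kn.1) (x (nth 0%N (discoverers J x kn.2) j))].
    move=> /js_gt; have [[n [i' [jn Ji']]]|nJ] :=
      pselect (exists n i', (j < size (discoverers J x n))%N /\
        J i' (x (nth 0%N (discoverers J x n) j))); last first.
      rewrite species_frequency_isolated => [|n i' jn Ji']; last first.
        by apply: nJ; exists n, i'.
      by rewrite lte_fin ltNge t0.
    rewrite (species_frequency_interval jn Ji') lte_fin => ti'.
    have [[k _ fk]|/f0 i'0] := pselect (range f i'); last first.
      by move: ti'; rewrite i'0 ltNge t0.
    by exists (k, n); split=> //; rewrite ?fk// -fs fk.
  have [g gP] : {g : nat -> nat * nat & forall j, j \in js -> [/\ t < s (g j).1,
      (j < size (discoverers J x (g j).2))%N &
      J (f (g j).1) (x (nth 0%N (discoverers J x (g j).2) j))]}.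
    apply: (@choice _ _ (fun j kn => j \in js -> [/\ t < s kn.1,
      (j < size (discoverers J x kn.2))%N &
      J (f kn.1) (x (nth 0%N (discoverers J x kn.2) j))])) => j.
    have [/rank[kn h]|] := boolP (j \in js); first by exists kn.
    by exists (0, 0)%N.
  (* Distinct species have distinct ranks, so one of the [i + 1] ranks is at
     least [i]. *)
  have [k kin ik] : exists2 k, k \in [seq (g j).1 | j <- js] & (i <= k)%N.
    apply: contrapT => nk.
    have := @uniq_leq_size _ [seq (g j).1 | j <- js] (iota 0 i).
    rewrite size_map size_iota szjs ltnn => F; suff : false by [].
    apply: F => [|k kin].
      rewrite map_inj_in_uniq// => j j' /gP[_ js_ jJ] /gP[_ js'_ jJ'] eqk.
      pose n := maxn (g j).2 (g j').2.
      have [jn E] := nth_discoverers (leq_maxl (g j).2 (g j').2) js_.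
      have [jn' E'] := nth_discoverers (leq_maxr (g j).2 (g j').2) js'_.
      apply/eqP; rewrite -(nth_uniq 0%N jn jn' (discoverers_uniq J x n));
        apply/eqP.
      apply: (@discoverers_same _ J x n); rewrite ?mem_nth//.
      by rewrite (same_species_in_interval (i := f (g j).1)) ?E//;
        apply/asboolP;
        rewrite E' eqk.
    by rewrite mem_iota add0n ltnNge; apply/negP => ik; apply: nk; exists k.
  have /mapP[j /gP[tk _ _] kE] := kin.
  by rewrite (lt_le_trans tk)// -kE sdecr.
Qed.

End discovery.

Section consistency_sets.
Variable R : realType.

Lemma measurable_path_step n : measurable_fun [set: cpath] (fun y : cpath =>
  y n).
Proof.
move=> _ B mB; rewrite setTI; apply: sub_sigma_algebra; exists n => //.
by exists B; rewrite ?setTI.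
Qed.

Lemma measurable_species_frequency j :
  measurable_fun [set: cpath] (fun y => species_frequency R y j).
Proof.
apply: measurable_fun_limn_esup => r; apply/measurable_EFinP.
apply: measurable_funM => //.
have mnth : measurable_fun [set: composition] (fun c : composition =>
  (nth 0%N c j)%:R : R).
  by [].
exact: (measurableT_comp mnth (measurable_path_step _)).
Qed.

Definition frequent_species (t : R) i : set cpath :=
  [set y | exists js : seq nat, [/\ size js = i.+1, uniq js &
    forall j, j \in js -> (t%:E < species_frequency R y j)%E]].

Lemma measurable_frequent_species t i : measurable (frequent_species t i).
Proof.
have -> : frequent_species t i = \bigcup_(js : seq nat)
    ([set y | size js = i.+1 /\ uniq js] `&`
     \bigcap_(j in [set` js]) [set y | (t%:E < species_frequency R y j)%E]).
  apply/seteqP; split=> y.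
    by move=> [js [? ? h]]; exists js => //; split=> // j; exact: h.
  by move=> [js _ [[? ?] h]]; exists js; split=> // j; exact: h.
apply: countable_bigcupT_measurable => // js; apply: measurableI.
  have [h|h] := pselect (size js = i.+1 /\ uniq js).
    by rewrite (_ : [set _ | _] = setT)//; apply/seteqP; split.
  by rewrite (_ : [set _ | _] = set0)//; apply/seteqP; split.
apply: fin_bigcap_measurable => // j _.
rewrite -[X in measurable X]setTI.
have := measurable_species_frequency j measurableT (emeasurable_itv `]t%:E,
  +oo[).
by congr measurable; apply/seteqP; split=> y /=; rewrite in_itv/= andbT.
Qed.

End consistency_sets.

(** * Measurability of the species relation *)

Section species_measurable.
Variables (R : realType) (J : massPartition R -> nat -> set R).
Hypothesis hJ : interval_representation J.
Variables (d : measure_display) (T : measurableType d).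
(** [sg] is the random mass partition and [xi] the individuals, on any space:
    this covers the sample space, its product with the mass partitions, and a
    fixed mass partition. *)
Variables (sg : T -> massPartition R) (xi : nat -> T -> R).
Hypotheses (msg : measurable_fun setT sg) (mxi : forall l,
  measurable_fun setT (xi l)).

Lemma measurable_in_interval i l : measurable [set w | J (sg w) i (xi l w)].
Proof.
have mp : measurable_fun setT (fun w => (sg w, xi l w)) by exact:
  measurable_fun_pair.
rewrite -[X in measurable X]setTI; exact:
  (mp measurableT _ (J_measurable hJ i)).
Qed.

Lemma measurable_same_species l m :
  measurable [set w | same_species (J (sg w)) (xi ^~ w) l m].
Proof.
have -> : [set w | same_species (J (sg w)) (xi ^~ w) l m] =
    [set w | l == m] `|` \bigcup_i ([set w | J (sg w) i (xi l w)] `&`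
                                   [set w | J (sg w) i (xi m w)]).
  apply/seteqP; split=> w /=.
    by move=> /orP[->|/asboolP[i [? ?]]]; [left|right; exists i].
  by move=> [lm|[i _ [? ?]]]; apply/orP; [left|right; apply/asboolP; exists i].
apply: measurableU.
  by case: (l == m); [rewrite (_ : [set _ | _] = setT)//|rewrite (_ :
    [set _ | _] = set0)//];
    apply/seteqP; split.
apply: bigcup_measurable => i _; apply: measurableI; exact:
  measurable_in_interval.
Qed.

Definition species_matrix_event n (r : {ffun 'I_n * 'I_n -> bool}) : set T :=
  [set w | forall l m : 'I_n, same_species (J (sg w)) (xi ^~ w) l m = r (l, m)].

Lemma measurable_species_matrix_event n (r : {ffun 'I_n * 'I_n -> bool}) :
  measurable (species_matrix_event r).
Proof.
have -> : species_matrix_event r = \bigcap_(l : 'I_n) \bigcap_(m : 'I_n)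
    [set w | same_species (J (sg w)) (xi ^~ w) l m = r (l, m)].
  by apply/seteqP; split=> w h l => [_ m _|m]; [exact: h|exact: (h l I m I)].
apply: fin_bigcap_measurable => // l _.
apply: fin_bigcap_measurable => // m _.
have ms := measurable_same_species l m.
case: (r _) => //; rewrite (_ :
  [set _ | _] = ~` [set w | same_species (J (sg w)) (xi ^~ w) l m]).
  exact: measurableC.
by apply/seteqP; split=> w /= => [->|/negP/negbTE].
Qed.

Lemma trivIset_species_matrix_event n :
  trivIset setT (@species_matrix_event n).
Proof.
move=> r r' _ _ [w [h h']]; apply/ffunP => -[l m].
by rewrite -h -h'.
Qed.

(** This reduces measurability, and later integrals, of what the species
    relation decides to the finitely many values of that relation. *)
Lemma species_matrix_decomposition n (H : set T) :
  (forall w w', (forall l m : 'I_n, same_species (J (sg w)) (xi ^~ w) l m =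
                      same_species (J (sg w')) (xi ^~ w') l m) -> H w -> H w')
                        ->
  H = \big[setU/set0]_(r <- enum [pred r | `[< @species_matrix_event n r `&` H
    !=set0 >]])
        species_matrix_event r.
Proof.
move=> Hsat; apply/seteqP; split=> w.
  move=> Hw; pose r := [ffun lm : 'I_n * 'I_n =>
    same_species (J (sg w)) (xi ^~ w) lm.1 lm.2].
  have Er : species_matrix_event r w by move=> l m; rewrite ffunE.
  rewrite -bigcup_seq; exists r => //=; rewrite mem_enum.
  by apply/asboolP; exists w; split.
rewrite -bigcup_seq => -[r /=]; rewrite mem_enum => /asboolP[w' [Er' Hw']] Er.
by apply: Hsat Hw' => l m; rewrite Er Er'.
Qed.

Lemma measurable_species_counts n :
  measurable_fun setT (fun w => species_counts (J (sg w)) (xi ^~ w) n).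
Proof.
move=> _ B _; rewrite setTI.
set H := (X in measurable X).
have -> := @species_matrix_decomposition n H.
  by apply: bigsetU_measurable => r _; exact: measurable_species_matrix_event.
move=> w w' eqs; rewrite /H /=; congr B; apply: eq_species_counts => l m ln mn.
exact: (eqs (Ordinal ln) (Ordinal mn)).
Qed.

Lemma measurable_species_path :
  measurable_fun setT (fun w => species_path (J (sg w)) (xi ^~ w)).
Proof.
apply: (@measurability _ _ _ _ _ _
  (\bigcup_(n in setT) preimage_set_system setT (fun y : cpath =>
    y n) measurable)).
  by [].
move=> _ [_ [n _ [B mB <-]] <-].
have := measurable_species_counts n.+1 measurableT mB.
by congr measurable; apply/seteqP; split=> w /= [].
Qed.

Lemma measurable_mass_species_path :
  measurable_fun setT (fun w => (sg w, species_path (J (sg w)) (xi ^~ w))).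
Proof. exact: (measurable_fun_pair msg measurable_species_path). Qed.

End species_measurable.

Section exchangeability.
Variable R : realType.

Definition real_cylinders : set (set (nat -> R)) :=
  [set C | exists N (B : nat -> set R), [/\ forall l, measurable (B l),
     forall l, (N <= l)%N -> B l = setT & C = [set x | forall l, B l (x l)]]].

Let seqR := g_sigma_algebraType real_cylinders.

Lemma real_cylindersI : setI_closed real_cylinders.
Proof.
move=> _ _ [N [B [mB BT ->]]] [N' [B' [mB' B'T ->]]].
exists (maxn N N'), (fun l => B l `&` B' l); split.
- by move=> l; exact: measurableI.
- by move=> l; rewrite geq_max => /andP[? ?]; rewrite BT// B'T// setTI.
- by apply/seteqP; split=> x /= => [[h h'] l|h]; split=> // l; have [] := h l.
Qed.

Lemma measurable_coordinate l : measurable_fun [set: seqR] (fun x : seqR =>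
  x l).
Proof.
move=> _ B mB; rewrite setTI; apply: sub_sigma_algebra.
exists l.+1, (fun k => if k == l then B else setT); split.
- by move=> k; case: ifP.
- by move=> k lk; rewrite gtn_eqF.
- by apply/seteqP; split=> x /= => [xB k|/(_ l)]; [case: eqP => //
  ->|rewrite eqxx].
Qed.

Variables (d : measure_display) (Omega : measurableType d) (Q :
  probability Omega R).
Variable X : nat -> {RV Q >-> R}.
Hypothesis X_indep : independent_RVs Q X.
Hypothesis X_id : forall l m A, measurable A
  -> Q (X l @^-1` A) = Q (X m @^-1` A).

Let measurable_seq (u : nat -> nat) :
  measurable_fun setT (fun w => (fun l => X (u l) w) : seqR).
Proof.
apply: (@measurability _ _ Omega seqR setT _ real_cylinders) =>
  // _ [_ [N [B [mB BT ->]]] <-].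
rewrite setTI (_ : _ @^-1` _ = \bigcap_l (X (u l) @^-1` B l)); last first.
  by apply/seteqP; split=> w /= h l; [move=> _; exact: h|exact: (h l I)].
apply: bigcapT_measurable => l; rewrite -[X in measurable X]setTI.
exact: measurable_funPT.
Qed.

(** Both laws on sequences give a cylinder the product of the probabilities of
    its sides, and the cylinders are a pi-system. *)
Lemma iid_reindex (u v : nat -> nat) (C : set seqR) : cancel u v
  -> measurable C ->
  Q [set w | C (X ^~ w)] = Q [set w | C (fun l => X (u l) w)].
Proof.
move=> uv mC.
pose f1 : {mfun Omega >-> seqR} := HB.pack (fun w => (X ^~ w) : seqR)
  (isMeasurableFun.Build _ _ _ _ _ (measurable_seq id)).
pose f2 : {mfun Omega >-> seqR} := HB.pack (fun w => (fun l => X (u l) w) :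
  seqR)
  (isMeasurableFun.Build _ _ _ _ _ (measurable_seq u)).
have indep (t s : nat -> nat) N (B : nat -> set R) : cancel t s ->
    (forall l, measurable (B l)) -> (forall l, (N <= l)%N -> B l = setT) ->
    Q [set w | forall l, B l (X (t l) w)] = (\prod_(l < N) Q (X (t l) @^-1` B
      l))%E.
  move=> ts mB BT.
  have := X_indep (D := map t (iota 0 N)) (B := B \o s)
    ltac:(by rewrite map_inj_uniq ?iota_uniq//; exact: can_inj ts)
    (fun l => mB (s l)).
  rewrite big_map -[N in iota 0 N]subn0 -/(index_iota 0 N) big_mkord => h.
  transitivity (\prod_(i < N) Q (X (t i) @^-1` (B \o s) (t i)))%E; last first.
    by apply: eq_bigr => i _; rewrite /= ts.
  rewrite -h; congr (Q _); apply/seteqP; split=> w /= Bw.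
    by move=> _ /mapP[l _ ->] /=; rewrite ts; exact: Bw.
  move=> l; have [Nl|lN] := leqP N l; first by rewrite BT.
  rewrite -[X in B X _](ts l); apply: (Bw (t l)) => /=.
  by rewrite map_f// mem_index_iota.
have := @measure_unique _ R seqR real_cylinders (fun=>
  setT) erefl real_cylindersI
  _ _ (distribution Q f1) (distribution Q f2) _ _ C mC; apply.
- by move=> _; exists 0%N, (fun=> setT); split=> //; apply/seteqP; split.
- by apply/seteqP; split=> // x _; exists 0%N.
- move=> _ [N [B [mB BT ->]]].
  rewrite -[LHS]/(Q [set w | forall l, B l (X (id l) w)]).
  rewrite -[RHS]/(Q [set w | forall l, B l (X (u l) w)]).
  rewrite (indep id id N)// (indep u v N)//; apply: eq_bigr => l _; exact: X_id.
- by move=> k; rewrite (le_lt_trans (probability_le1 _ _))// ltry.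
Qed.

Variables (J : massPartition R -> nat -> set R) (s : massPartition R).
Hypothesis hJ : interval_representation J.

(** Relabelling the individuals by [p^-1] turns the event of [r] into the event
    of [r'], and it preserves their law. *)
Lemma species_matrix_event_perm n (p : 'S_n) (r r' : {ffun 'I_n * 'I_n
  -> bool}) :
  (forall l m, r' (l, m) = r (p l, p m)) ->
  Q (species_matrix_event J (cst s) X r) = Q (species_matrix_event J (cst s) X
    r').
Proof.
move=> rr'.
(* [p] permutes the first [n] individuals and fixes the others. *)
pose ext (q : 'S_n) l := if insub l is Some i then nat_of_ord (q i) else l.
have extE (q : 'S_n) (i : 'I_n) : ext q i = q i by rewrite /ext valK.
have extK : cancel (ext p^-1%g) (ext p).
  move=> l; rewrite {2}/ext; case: insubP => [i _ il|/negbTE ln].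
    by rewrite extE permKV il.
  by rewrite /ext; case: insubP => //; rewrite ln.
pose C : set seqR := species_matrix_event J (cst s) (fun l (x : seqR) => x l) r.
have mC : measurable C.
  apply: measurable_species_matrix_event => //; exact: measurable_coordinate.
have := iid_reindex extK mC => /= E.
have sameE w l m : same_species (J s) (fun k => X (ext p^-1%g k) w) l m =
    same_species (J s) (X ^~ w) (ext p^-1%g l) (ext p^-1%g m).
  by rewrite /same_species (can_eq extK).
rewrite -[LHS]/(Q [set w | C (X ^~ w)]) E; congr (Q _); apply/seteqP; split=>
  w h l m.
- rewrite rr' -h [RHS]sameE !extE !permK; reflexivity.
- rewrite [LHS]sameE -[l](permKV p) -[m](permKV p) !extE !permK -rr'; exact: h.
Qed.

End exchangeability.

(** * Events of the path *)

Lemma adapted_preimage_cst (R : realType) d d' (T : measurableType d)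
    (T' : measurableType d') (f : T -> T') (g : T -> R) z z' :
  adapted_to (g_sigma_algebra_preimage f) g -> f z = f z' -> g z = g z'.
Proof.
move=> Fg zz'; have [C _ CE] := Fg _ (measurable_set1 (g z)).
have : (g @^-1` [set g z]) z by [].
rewrite -CE => -[_ Cz].
have : ([set: T] `&` f @^-1` C) z' by split=> //=; rewrite -zz'.
by rewrite CE => /= ->.
Qed.

Section coordinates.
Variable R : realType.
Local Notation Z := (massPartition R * cpath)%type.

Lemma measurable_pi n : measurable_fun [set: Z] (@pi_ R n).
Proof. exact: (measurableT_comp (measurable_path_step n) measurable_snd). Qed.

Lemma sigma_algebra_pi n :
  sigma_algebra setT (g_sigma_algebra_preimage (@pi_ R n)).
Proof. exact/sigma_algebra_preimage/sigma_algebra_measurable. Qed.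

Lemma sub_pi_measurable n : g_sigma_algebra_preimage (@pi_ R n) `<=` measurable.
Proof. by move=> _ [B mB <-]; exact: measurable_pi. Qed.

Lemma sub_pi_B n : g_sigma_algebra_preimage (@pi_ R n) `<=` B_ n.
Proof. by move=> A [B mB <-]; apply: sub_sigma_algebra; exists n => //=;
  exists B. Qed.

Lemma B_filtration : is_filtration (@B_ R).
Proof.
split=> [n|n|m n mn].
- exact: (@smallest_sigma_algebra _ setT _).
- apply: smallest_sub; first exact: sigma_algebra_measurable.
  by move=> _ [m _ [B mB <-]]; exact: measurable_pi.
- apply: sub_sigma_algebra2 => A [k /= km h]; exists k => //=; exact:
  leq_trans mn.
Qed.

Lemma B_saturated n (H : set Z) : B_ n H ->
  forall z z', (forall m, (m <= n)%N -> z.2 m = z'.2 m) -> H z -> H z'.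
Proof.
pose K := [set H : set Z | forall z z',
  (forall m, (m <= n)%N -> z.2 m = z'.2 m) -> H z -> H z'].
suff : @B_ R n `<=` K by move=> /[apply].
apply: smallest_sub; first split.
- by [].
- move=> A KA z z' zz'; rewrite setTD => nA A'; apply: nA.
  by apply: KA A' => m mn; rewrite zz'.
- by move=> A KA z z' zz' [i _ Ai]; exists i => //; exact: KA Ai.
move=> _ [m /= mn [B mB <-]] z z' zz' /= [_ Bz]; split=> //.
by rewrite /pi_ /= -zz'.
Qed.

Lemma path_event_sub (C : set cpath) : measurable C ->
  <<s \bigcup_n @B_ R n >> (snd @^-1` C).
Proof.
suff : cpath_measurable `<=`
    [set C | <<s \bigcup_n @B_ R n >> ((snd : massPartition R * cpath
      -> cpath) @^-1` C)].
  by apply.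
apply: smallest_sub.
  split=> [|A mA|A mA].
  - by rewrite /= preimage_set0; exact: sigma_algebra0.
  - by rewrite setTD /= preimage_setC; exact: sigma_algebraC.
  - by rewrite /= preimage_bigcup; exact: sigma_algebra_bigcup.
move=> _ [n _ [B mB <-]] /=; apply: sub_sigma_algebra; exists n => //.
apply: sub_sigma_algebra; exists n => //=; exists B => //.
Qed.

End coordinates.

(** * Laws restricted to an event, uniform law of an interval *)

(** Both sides integrate [G] against the law of [S] restricted to an event. *)
Lemma integral_comp_event_eq (R : realType) d d' (T : measurableType d)
    (T' : measurableType d') (Q : probability T R) (S : {mfun T >-> T'})
    (E E' : set T) (G : T' -> \bar R) :
  measurable E -> measurable E' -> measurable_fun setT G ->
  (forall A, measurable A -> Q (S @^-1` A `&` E) = Q (S @^-1` A `&` E')) ->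
  (\int[Q]_(w in E) G (S w) = \int[Q]_(w in E') G (S w))%E.
Proof.
move=> mE mE' mG EE'.
have ge0 (D : set T) (mD : measurable D) (h : T' -> \bar R) :
    measurable_fun setT h -> (forall y, 0 <= h y)%E ->
    (\int[Q]_(w in D) h (S w) = \int[pushforward (mrestr Q mD) S]_y h y)%E.
  move=> mh h0.
  rewrite ge0_integral_pushforward//= preimage_setT.
  have mhS : measurable_fun setT (h \o S) by exact: measurableT_comp.
  rewrite (@ge0_negligible_integral _ _ _ (mrestr Q mD) setT (~` D) _
    (measurableC mD))//; last by rewrite /= /mrestr setICl measure0.
  rewrite setTD setCK; apply: eq_measure_integral => A mA AD.
  by rewrite /= /mrestr setIidl.
have eqn (h : T' -> \bar R) : measurable_fun setT h -> (forall y, 0 <= h y)%E ->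
    (\int[Q]_(w in E) h (S w) = \int[Q]_(w in E') h (S w))%E.
  move=> mh h0; rewrite (ge0 E mE)// (ge0 E' mE')//.
  by apply: eq_measure_integral => A mA _; exact: EE'.
rewrite integralE [RHS]integralE; congr (_ - _)%E.
  rewrite -[(fun w => G (S w))]/(G \o S) funepos_comp.
  by apply: (eqn (G^\+)%E) => //; exact: measurable_funepos.
rewrite -[(fun w => G (S w))]/(G \o S) funeneg_comp.
by apply: (eqn (G^\-)%E) => //; exact: measurable_funeneg.
Qed.

Lemma uniform_prob_open_itv (R : realType) (a b : R) :
  0 <= a -> a <= b -> b <= 1 ->
  uniform_prob (@ltr01 R) `]a, b[%classic =
  (fine (lebesgue_measure `]a, b[%classic))%:E.
Proof.
move=> a0 ab b1; rewrite /uniform_prob.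
transitivity (\int[lebesgue_measure]_(x in `]a, b[%classic) (cst 1%E x))%E.
  apply: eq_integral => x; rewrite inE /= in_itv /= => /andP[ax xb].
  by rewrite /uniform_pdf subr0 invr1 (le_trans a0 (ltW ax)) (le_trans (ltW xb)
    b1).
rewrite integral_cst// mul1e fineK//.
rewrite lebesgue_measure_itv/=; case: ifP => // _.
Qed.

(** * The species sampling scheme *)

Section species_sampling.
Variables (R : realType) (P : probability (massPartition R) R).
Variables (J : massPartition R -> nat -> set R) (hJ :
  interval_representation J).
Variables (d : measure_display) (Omega : measurableType d) (Q :
  probability Omega R).
Variables (S : {RV Q >-> massPartition R}) (X : nat -> {RV Q >-> R}).
Hypothesis hS : forall A, measurable A -> distribution Q S A = P A.
Hypothesis hX_unif : forall l A, measurable A ->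
  distribution Q (X l) A = uniform_prob (@ltr01 R) A.
Hypothesis hX_indep : independent_RVs Q X.
Hypothesis hSX_indep : independent_systems Q
  (g_sigma_algebra_preimage S) (sigma_of setT X).
Local Notation Z := (massPartition R * cpath)%type.
Variable bP : probability (massPartition R * cpath)%type R.
Hypothesis hbP : forall A, measurable A ->
  bP A = Q ((fun w => (S w, species_path (J (S w)) (X ^~ w))) @^-1` A).

Let X_id l m A : measurable A -> Q (X l @^-1` A) = Q (X m @^-1` A).
Proof.
move=> mA; transitivity (uniform_prob (@ltr01 R) A).
  by rewrite -(hX_unif l mA).
by rewrite -(hX_unif m mA).
Qed.

(** The sample space seen through the individuals only: there the identity is
    a random element independent of [S]. *)
Let OX := g_sigma_algebraType
  (\bigcup_(i in setT) preimage_set_system setT (X i) measurable).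

Lemma measurable_individual l : measurable_fun [set: OX] (X l : OX -> R).
Proof.
move=> _ B mB; apply: sub_sigma_algebra; exists l => //.
by exists B.
Qed.

Let sub_OX (A : set OX) : measurable A -> (measurable : set (set Omega)) A.
Proof.
apply: smallest_sub; first exact: sigma_algebra_measurable.
move=> _ [l _ [B mB <-]]; exact: measurable_funPT.
Qed.

Let measurable_idOX : measurable_fun [set: Omega] (idfun : Omega -> OX).
Proof. by move=> _ A mA; rewrite setTI; exact: sub_OX. Qed.

(** Independence makes the law of [w |-> (S w, w)] a product, and Fubini's
    theorem then reduces statements on the pair to a fixed mass partition. *)
Lemma joint_law (E : set (massPartition R * OX)) : measurable E ->
  Q [set w | E (S w, w)] = (\int[P]_s Q [set w | E (s, w)])%E.
Proof.
move=> mE.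
pose f : {mfun Omega >-> OX} := HB.pack (idfun : Omega -> OX)
  (isMeasurableFun.Build _ _ _ _ _ measurable_idOX).
pose QX : probability OX R := distribution Q f.
have mf2 : measurable_fun setT (fun w => (S w, w) :
  (massPartition R * OX)%type).
  exact: (measurable_fun_pair (measurable_funPT S) measurable_idOX).
pose f2 : {mfun Omega >-> (massPartition R * OX)%type} := HB.pack
  (fun w => (S w, w) : (massPartition R * OX)%type) (isMeasurableFun.Build _ _
    _ _ _ mf2).
transitivity ((P \x QX)%E E); last first.
  rewrite /= /product_measure1; apply: eq_integral => s _ /=.
  by congr (Q _); apply/seteqP; split=> w; rewrite /xsection /= inE.
apply/esym.
apply: (@product_measure_unique _ _ _ _ _ P QX (distribution Q f2)) =>
  // A B mA mB.
rewrite -[LHS]/(Q ((S @^-1` A) `&` B)) hSX_indep//.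
  by congr (_ * _)%E; exact: (hS mA).
by exists A; rewrite ?setTI.
Qed.

Lemma species_law (E : set (massPartition R * cpath)) : measurable E ->
  bP E = (\int[P]_s Q [set w | E (s, species_path (J s) (X ^~ w))])%E.
Proof.
move=> mE; rewrite hbP//.
pose Psi (z : (massPartition R * OX)%type) := (z.1,
  species_path (J z.1) (X ^~ z.2)).
have mPsi : measurable_fun setT Psi.
  apply: (@measurable_mass_species_path _ _ hJ _ (massPartition R * OX)%type fst
    (fun l z => X l z.2)) => // l.
  by apply: (measurableT_comp (measurable_individual l)).
apply: (joint_law (E := Psi @^-1` E)).
by rewrite -[X in measurable X]setTI; exact: mPsi.
Qed.

(** Exchangeability holds for every fixed mass partition, hence jointly with
    [S]. *)
Lemma joint_matrix_event_perm n (p : 'S_n) (r r' : {ffun 'I_n * 'I_n -> bool})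
    (A : set (massPartition R)) : measurable A ->
  (forall l m, r' (l, m) = r (p l, p m)) ->
  Q (S @^-1` A `&` species_matrix_event J S X r) =
  Q (S @^-1` A `&` species_matrix_event J S X r').
Proof.
move=> mA rr'.
pose E (r : {ffun 'I_n * 'I_n -> bool}) : set (massPartition R * OX) :=
  fst @^-1` A `&` species_matrix_event J fst (fun l z => X l z.2) r.
have mE r0 : measurable (E r0).
  apply: measurableI.
    by rewrite -[X in measurable X]setTI; exact: measurable_fst.
  apply: measurable_species_matrix_event => // l.
  by apply: (measurableT_comp (measurable_individual l)).
have Ej r0 : Q (S @^-1` A `&` species_matrix_event J S X r0) =
    (\int[P]_s Q [set w | E r0 (s, w)])%E.
  by rewrite -(joint_law (mE r0)).
rewrite !Ej; apply: eq_integral => s _.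
have [As|nAs] := pselect (A s).
  have Es r0 : [set w | E r0 (s, w)] = species_matrix_event J (cst s) X r0.
    by apply/seteqP; split=> w => [[_]|].
  by rewrite !Es; exact: species_matrix_event_perm rr'.
have Es r0 : [set w | E r0 (s, w)] = set0.
  by apply/seteqP; split=> w // -[].
by rewrite !Es.
Qed.

Lemma measurable_interval s i : measurable (J s i).
Proof. by have [a [b [_ _ _ ->]]] := J_open_itv hJ s i. Qed.

Lemma in_interval_prob s i l :
  Q (X l @^-1` J s i) = (fine (lebesgue_measure (J s i)))%:E.
Proof.
rewrite -[LHS]/(distribution Q (X l) (J s i)) hX_unif; last exact:
  measurable_interval.
have [a [b [a0 ab b1 ->]]] := J_open_itv hJ s i; exact: uniform_prob_open_itv.
Qed.

Lemma interval_frequencies_cvg s : {ae Q, forall w, forall i,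
  (\sum_(m < 2 ^ r) `[< J s i (X m w) >])%N%:R / (2 ^ r)%:R @[r --> \oo] -->
  fine (lebesgue_measure (J s i))}.
Proof.
apply/ae_foralln => i.
have mXJ m : measurable (X m @^-1` J s i).
  by rewrite -[X in measurable X]setTI; apply: measurable_funPT => //; exact:
    measurable_interval.
have := @frequency_cvg_pow2 _ _ _ Q (fun m => X m @^-1` J s i)
  (fine (lebesgue_measure (J s i))) mXJ (fun m => in_interval_prob s i m).
have QJJ m k : m != k -> Q (X m @^-1` J s i `&` X k @^-1` J s i) =
    (fine (lebesgue_measure (J s i)) * fine (lebesgue_measure (J s i)))%:E.
  move=> mk; have := hX_indep (D := [:: m; k]) (B := fun=> J s i).
  rewrite /= inE mk /= !big_cons big_nil mule1 !in_interval_prob -EFinM =>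
    <- //.
    congr (Q _); apply/seteqP; split=> w /=.
      by move=> [? ?] l /=; rewrite !inE => /orP[/eqP ->|/eqP ->].
    by move=> h; split; apply: h => /=; rewrite !inE eqxx ?orbT.
  by move=> _; exact: measurable_interval.
have sumE w : (fun r => (\sum_(m < 2 ^ r) \1_(X m @^-1` J s i) w) / (2 ^ r)%:R)
  =
    (fun r => (\sum_(m < 2 ^ r) `[< J s i (X m w) >])%N%:R / (2 ^ r)%:R) :>
      (nat -> R).
  apply/funext => r; congr (_ / _); rewrite natr_sum; apply: eq_bigr => m _.
  by rewrite indicE; congr (nat_of_bool _)%:R.
by move=> /(_ QJJ); apply: filterS => w; rewrite sumE.
Qed.

(** By [species_law] it is enough to compare both sides for a fixed mass
    partition, along a sequence of individuals with the right frequencies. *)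
Lemma mass_gt_ae (t : R) i : 0 <= t ->
  {ae bP, forall z : massPartition R * cpath,
    t < z.1 i <-> frequent_species t i z.2}.
Proof.
move=> t0; pose E1 : set (massPartition R * cpath) := [set z :
  massPartition R * cpath | t < z.1 i].
pose E2 : set (massPartition R * cpath) := snd @^-1` frequent_species t i.
have mmass : measurable_fun [set: massPartition R] (fun s : massPartition R =>
  s i).
  move=> _ B mB; rewrite setTI; apply: sub_sigma_algebra; exists i => //.
  by exists B; rewrite ?setTI.
have mE1 : measurable E1.
  have := measurableT_comp mmass (@measurable_fst _ _ (massPartition R) cpath).
  move=> /(_ measurableT _ (measurable_itv `]t, +oo[)); rewrite setTI.
  by congr measurable; apply/seteqP; split=> z /=; rewrite in_itv/= andbT.
have mE2 : measurable E2.
  by rewrite -[X in measurable X]setTI; apply: measurable_snd => //; exact: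
    measurable_frequent_species.
pose E := (E1 `\` E2) `|` (E2 `\` E1).
have mE : measurable E by apply: measurableU; exact: measurableD.
exists E; split=> //; last first.
  move=> z nz; apply: contrapT => nE; apply: nz; split=> h.
    by apply: contrapT => h'; apply: nE; left.
  by apply: contrapT => h'; apply: nE; right.
rewrite (species_law mE).
apply: integral0_eq => s _; apply/negligibleP.
  rewrite -[X in measurable X]setTI.
  apply: (measurable_mass_species_path hJ (sg := cst s) (xi :=
    X) _ _ measurableT mE) => //.
apply: negligibleS (interval_frequencies_cvg s) => w.
move=> /= Ew freq; have := @mass_gt_frequency _ (J s) (X ^~ w) (@J_disjoint _ _
  hJ s) s (J_lengths hJ s) freq t i t0.
by case: Ew => -[h nh] [hto hfrom]; apply: nh; [exact: hto|exact: hfrom].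
Qed.

(** Consistency: the path determines the mass partition.  The events of [S]
    that the path decides up to a null set form a sigma-algebra, which contains
    the generators [t < s i]. *)
Lemma mass_event_ae (A : set (massPartition R)) : measurable A ->
  exists2 C : set cpath, measurable C & {ae bP, forall z, A z.1 <-> C z.2}.
Proof.
pose H := [set A : set (massPartition R) | exists2 C : set cpath, measurable C &
  {ae bP, forall z, A z.1 <-> C z.2}].
have H0 : H set0 by exists set0 => //; apply: aeW.
have HC B : H B -> H (~` B).
  move=> [C mC BC]; exists (~` C); first exact: measurableC.
  by apply: filterS BC => z [h h']; split=> n; apply: contra_not n.
have HU (B : nat -> set (massPartition R)) : (forall n, H (B n))
  -> H (\bigcup_n B n).
  move=> HB.
  have [C CP] : {C : nat -> set cpath & forall n, measurable (C n) /\
      {ae bP, forall z, B n z.1 <-> C n z.2}}.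
    apply: (@choice _ _ (fun n C => measurable C /\ {ae bP, forall z,
      B n z.1 <-> C z.2})) => n.
    by have [C mC BC] := HB n; exists C.
  exists (\bigcup_n C n); first by apply: bigcup_measurable => n _; have [] :=
    CP n.
  have /ae_foralln : forall n, {ae bP, forall z, B n z.1 <-> C n z.2}.
    by move=> n; have [] := CP n.
  by apply: filterS => z BCz; split=> -[n _ h]; exists n => //; apply/BCz.
suff : mass_measurable (R := R) `<=` H by apply.
apply: smallest_sub.
  by split=> //; move=> B HB; rewrite setTD; exact: HC.
move=> _ [i _ [B mB <-]]; rewrite setTI; move: B mB.
suff raysH : <<s @RGenOInfty.G R >> `<=`
    [set B | H ((fun s : massPartition R => s i) @^-1` B)].
  move=> B mB; apply: raysH.
  have : (@RGenOInfty.G R).-sigma.-measurable B by rewrite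
    -RGenOInfty.measurableE.
  exact.
apply: smallest_sub.
  split=> [|B HB|B HB].
  - by rewrite /= preimage_set0.
  - by rewrite setTD /= preimage_setC; exact: HC.
  - by rewrite /= preimage_bigcup; exact: HU.
move=> _ [t ->] /=; have [t0|t0] := leP 0 t.
  exists (frequent_species t i); first exact: measurable_frequent_species.
  apply: filterS (mass_gt_ae i t0) => z h.
  by rewrite -h /= in_itv/= andbT.
exists setT => //; apply: aeW => z; split=> // _ /=.
by rewrite in_itv/= andbT (lt_le_trans t0)// mass_ge0.
Qed.

Let mpath : measurable_fun setT
  (fun w => (S w, species_path (J (S w)) (X ^~ w))).
Proof. exact: (measurable_mass_species_path hJ (sg := S) (xi := X)). Qed.

Let Th : {mfun Omega >-> Z} := HB.pack
  (fun w => (S w, species_path (J (S w)) (X ^~ w)) : Z)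
  (isMeasurableFun.Build _ _ _ _ _ mpath).

Lemma ge0_integral_mass (h : massPartition R -> \bar R) :
  measurable_fun setT h -> (forall s, 0 <= h s)%E ->
  (\int[bP]_z h z.1 = \int[P]_s h s)%E.
Proof.
move=> mh h0.
have mhfst : measurable_fun setT (fun z : Z => h z.1).
  by apply: measurableT_comp.
rewrite (@eq_measure_integral _ _ _ _ (distribution Q Th)) => [|A mA _];
  last exact: hbP.
rewrite /distribution ge0_integral_pushforward//= preimage_setT.
rewrite [RHS](@eq_measure_integral _ _ _ _ (distribution Q S)) => [|A mA _];
  last first.
  by apply/esym; exact: hS.
by rewrite /distribution ge0_integral_pushforward//= preimage_setT.
Qed.

Lemma integrable_mass (G : massPartition R -> R) :
  P.-integrable setT (EFin \o G) -> bP.-integrable setT (EFin \o (fun z : Z =>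
    G z.1)).
Proof.
move=> IG; have mG := integrable_measurable IG.
have /integrableP[_ Goo] := IG; apply/integrableP; split.
  by apply/measurable_EFinP; apply: measurableT_comp.
rewrite (ge0_integral_mass (h := fun s => `|(G s)%:E|%E))//.
by apply/measurable_EFinP; exact: measurableT_comp.
Qed.

Let integral_path (h : Z -> R) H : measurable H ->
  bP.-integrable setT (EFin \o h) ->
  Q.-integrable setT (EFin \o (h \o Th)) /\
  (\int[bP]_(z in H) (h z)%:E = \int[Q]_(w in Th @^-1` H) (h (Th w))%:E)%E.
Proof.
move=> mH Ih; have mh := integrable_measurable Ih.
have IhTh : Q.-integrable setT (EFin \o (h \o Th)).
  apply/integrableP; split.
    by apply/measurable_EFinP; exact: measurableT_comp.
  have /integrableP[_] := Ih.
  rewrite (@eq_measure_integral _ _ _ _ (distribution Q Th)) => [|A mA _];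
    last exact: hbP.
  rewrite /distribution ge0_integral_pushforward//= ?preimage_setT//.
  by apply/measurable_EFinP; exact: measurableT_comp.
split=> //.
rewrite (@eq_measure_integral _ _ _ _ (distribution Q Th)) => [|A mA _];
  last exact: hbP.
rewrite /distribution integral_pushforward//.
- exact/measurable_EFinP.
- apply: (integrableS measurableT) => //; rewrite -[X in measurable X]setTI;
  exact: measurable_funPT.
Qed.


(** Sufficiency.  Put [h = g - G(S)].  An event of [B_ n] is a disjoint union of
    events [E r], on which the species relation of the first [n + 1] individuals
    is [r], so it is enough that the integral of [h] over [E r] be null.  This
    integral depends only on the counts [c] of [r]: relations with the same
    counts differ by a permutation of the individuals, and [g] is constant where
    [pi_ n] is [c].  The sum of the integrals over the relations with counts [c]
    is the integral of [h] over an event of [pi_ n], which is null. *)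
Lemma is_cond_exp_B (G : massPartition R -> R) n (g : Z -> R) :
  P.-integrable setT (EFin \o G) ->
  is_cond_exp bP (g_sigma_algebra_preimage (@pi_ R n)) (fun z => G z.1) g ->
  is_cond_exp bP (B_ n) (fun z => G z.1) g.
Proof.
move=> IG Hg; have [Fg Ig gE] := Hg.
have mG := integrable_measurable IG; have IGZ := integrable_mass IG.
have [_ Bm _] := B_filtration R.
split=> // [B mB|H BH]; first by apply: sub_pi_B; exact: Fg.
have mH := Bm n _ BH.
pose h z := g z - G z.1.
have Ih : bP.-integrable setT (EFin \o h) by exact: integrable_EFinB.
have [IhTh _] := integral_path measurableT Ih.
pose E (r : {ffun 'I_n.+1 * 'I_n.+1 -> bool}) := species_matrix_event J S X r.
have mE r : measurable (E r) by exact: measurable_species_matrix_event.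
have g_cst z z' : z.2 n = z'.2 n -> g z = g z' by exact:
  adapted_preimage_cst Fg.
have countsE r w w' m : E r w -> E r w' -> (m <= n)%N ->
    (Th w).2 m = (Th w').2 m.
  move=> Ew Ew' mn; apply: eq_species_counts => l k lm km.
  have ln : (l < n.+1)%N by rewrite (leq_trans lm).
  have kn : (k < n.+1)%N by rewrite (leq_trans km).
  by rewrite (Ew (Ordinal ln) (Ordinal kn)) (Ew' (Ordinal ln) (Ordinal kn)).
have decompose (K : set Z) : B_ n K -> measurable K ->
    (\int[bP]_(z in K) (h z)%:E = \sum_(r <- enum [pred r | `[< E r `&` (Th
      @^-1` K) !=set0 >]])
      \int[Q]_(w in E r) (h (Th w))%:E)%E.
  move=> BK mK; have [_ ->] := integral_path mK Ih.
  have KE := @species_matrix_decomposition _ J _ _ S X n.+1 (Th @^-1` K).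
  rewrite [X in integral _ X _]KE.
    apply: integral_bigsetU_EFin.
    - exact: mE.
    - exact: enum_uniq.
    - apply: (@sub_trivIset _ _ _ setT) => //.
      exact: trivIset_species_matrix_event.
    - exact/measurable_funTS/(measurable_int _ IhTh).
  move=> w w' ww'; apply: (B_saturated BK) => m mn.
  apply: eq_species_counts => l k lm km.
  have ln : (l < n.+1)%N by rewrite (leq_trans lm).
  have kn : (k < n.+1)%N by rewrite (leq_trans km).
  exact: (ww' (Ordinal ln) (Ordinal kn)).
have sum0 (K : set Z) : g_sigma_algebra_preimage (@pi_ R n) K ->
    (\int[bP]_(z in K) (h z)%:E = 0)%E.
  move=> FK; have mK := sub_pi_measurable FK.
  have IS (u : Z -> R) : bP.-integrable setT (EFin \o u)
    -> bP.-integrable K (EFin \o u).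
    exact: (integrableS measurableT).
  under eq_integral do rewrite /h EFinB.
  rewrite integralB_EFin//; [|exact: IS|exact: IS].
  by rewrite gE// subee// integrable_fin_num//; exact: IS.
have E0 r : (\int[Q]_(w in E r) (h (Th w))%:E = 0)%E.
  have [->|/set0P[w0 Ew0]] := eqVneq (E r) set0; first by rewrite integral_set0.
  pose c := (Th w0).2 n.
  pose K : set Z := [set: Z] `&` @pi_ R n @^-1` [set c].
  have FK : g_sigma_algebra_preimage (@pi_ R n) K by exists [set c].
  have := sum0 _ FK; rewrite decompose; [|exact: sub_pi_B|exact:
    sub_pi_measurable FK].
  set L := enum _.
  have same_int r' : r' \in L ->
      (\int[Q]_(w in E r') (h (Th w))%:E = \int[Q]_(w in E r) (h (Th w))%:E)%E.
    rewrite mem_enum => /asboolP[w1 [Ew1 [_ cw1]]].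
    have [p pP] := species_counts_perm (@J_disjoint _ _ hJ (S w0))
      (@J_disjoint _ _ hJ (S w1)) (esym cw1).
    have rr' l m : r' (l, m) = r (p l, p m) by rewrite -Ew1 -Ew0.
    have hE r1 w2 : E r1 w2 -> g (Th w2) = g (Th w0) ->
        {in E r1, forall w, (h (Th w))%:E = (g (Th w0) - G (S w))%:E}.
      move=> Ew2 gw2 w /set_mem Ew; rewrite /h -gw2 (g_cst (Th w) (Th w2))//.
      exact: countsE Ew Ew2 (leqnn n).
    rewrite (eq_integral _ _ (hE r' w1 Ew1 (g_cst _ _ cw1))).
    rewrite [RHS](eq_integral _ _ (hE r w0 Ew0 erefl)).
    apply: (@integral_comp_event_eq _ _ _ _ _ _ _ _ _ (fun s =>
      (g (Th w0) - G s)%:E)).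
    - exact: mE.
    - exact: mE.
    - by apply/measurable_EFinP; exact: measurable_funB.
    - by move=> A mA; apply/esym; apply: joint_matrix_event_perm rr'.
  rewrite (eq_big_seq (fun=> \int[Q]_(w in E r) (h (Th w))%:E)%E)//.
  have rL : r \in L by rewrite mem_enum; apply/asboolP; exists w0.
  have fin : (\int[Q]_(w in E r) (h (Th w))%:E)%E \is a fin_num.
    by apply: integrable_fin_num => //; exact: (integrableS measurableT).
  rewrite -(fineK fin) sumEFin big_const_seq count_predT iter_addr addr0.
  case=> /eqP; rewrite mulrn_eq0 => /orP[/nilP L0|/eqP -> //].
  by rewrite L0 in rL.
have : (\int[bP]_(z in H) (h z)%:E = 0)%E.
  by rewrite decompose//; apply: big1 => r _; exact: E0.
have IS (u : Z -> R) : bP.-integrable setT (EFin \o u)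
  -> bP.-integrable H (EFin \o u).
  exact: (integrableS measurableT).
under eq_integral do rewrite /h EFinB.
rewrite integralB_EFin//; [|exact: IS|exact: IS].
move=> gf0; have fin : (\int[bP]_(z in H) (G z.1)%:E)%E \is a fin_num.
  by apply: integrable_fin_num => //; exact: IS.
by rewrite -[LHS](subeK _ fin) gf0 add0e.
Qed.

Let filB := B_filtration R.

(** Up to a null set, an event of [S] is an event of the path. *)
Lemma levy_cvg_mass_indic (A : set (massPartition R)) : measurable A ->
  levy_cvg bP (@B_ R) (fun z => \1_A z.1).
Proof.
move=> mA; have [C mC AC] := mass_event_ae mA.
have IA : bP.-integrable setT (EFin \o (fun z : Z => \1_A z.1)).
  exact: (integrable_mass (integrable_indic P mA)).
have mC2 : measurable (snd @^-1` C : set Z).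
  by rewrite -[X in measurable X]setTI; exact: measurable_snd.
apply: (levy_cvg_closed filB IA) => e e0.
exists (\1_(snd @^-1` C)); split.
- exact: integrable_indic.
- by apply: levy_cvg_indic => //; exact: path_event_sub.
- rewrite (_ : (\int[bP]_w _)%E = 0%E) ?lee_fin ?ltW//.
  have mAC : measurable_fun setT (fun z : Z => (\1_A z.1 - \1_(snd @^-1` C) z :
    R)%:E).
    apply/measurable_EFinP/measurable_funB; last exact: measurable_indic.
    exact: (integrable_measurable IA).
  apply/(ae_eq_integral_abs bP measurableT mAC).
  apply: filterS AC => z AC _ /=.
  rewrite !indicE (_ : (z.1 \in A) = (z \in snd @^-1` C)) ?subrr//.
  by apply/idP/idP => /set_mem/AC/mem_set.
Qed.

Lemma levy_cvg_mass (G : massPartition R -> R) :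
  P.-integrable setT (EFin \o G) -> levy_cvg bP (@B_ R) (fun z => G z.1).
Proof.
move=> IG; have mG := integrable_measurable IG.
apply: (levy_cvg_closed filB (integrable_mass IG)) => e e0.
have [g' [Ig _ gG]] := approximation_sfun_integrable measurableT IG.
pose g_ k : massPartition R -> R := g' k.
have [k gk] : exists k, (\int[P]_s `|(EFin \o G) s - (g_ k s)%:E| <= e%:E)%E.
  move/fine_cvgP : gG => [[n1 _ h1] /cvgrPdist_le/(_ e e0)[n2 _ h2]].
  exists (maxn n1 n2); rewrite -(fineK (h1 _ (leq_maxl _ _))) lee_fin.
  have := h2 _ (leq_maxr n1 n2); rewrite /= sub0r normrN;
    exact/le_trans/ler_norm.
have gE : (fun z : Z => g_ k z.1) = (fun z =>
  \sum_(y <- finmap.enum_fset (fset_set (range (g_ k))))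
    y * \1_(g_ k @^-1` [set y]) z.1).
  apply/funext => z; rewrite /g_ fimfunE fsbig_finite//=.
have mpre y : measurable (g_ k @^-1` [set y]).
  by rewrite -[X in measurable X]setTI; exact: measurable_funPT.
have [Is Ls] := @levy_cvg_sum _ _ _ bP (@B_ R) filB _ (finmap.enum_fset
  (fset_set (range (g_ k)))) id
  (fun y z => \1_(g_ k @^-1` [set y]) z.1)
  (fun y => integrable_mass (integrable_indic P (mpre y)))
  (fun y => levy_cvg_mass_indic (mpre y)).
exists (fun z => g_ k z.1); split; [by rewrite gE|by rewrite gE|].
rewrite (ge0_integral_mass (h := fun s => `|(G s - g_ k s)%R|%:E)) //.
by apply/measurable_EFinP; apply: measurableT_comp => //; exact:
  measurable_funB.
Qed.

End species_sampling.

Theorem proposition1 (R : realType)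
  (P : probability (massPartition R) R)
  (J : massPartition R -> nat -> set R)
  (hJ : interval_representation J)
  (d : measure_display) (Omega : measurableType d) (Q : probability Omega R)
  (S : {RV Q >-> massPartition R}) (X : nat -> {RV Q >-> R})
  (hS : forall A, measurable A -> distribution Q S A = P A)
  (hX_unif : forall l A, measurable A ->
    distribution Q (X l) A = uniform_prob (@ltr01 R) A)
  (hX_indep : independent_RVs Q X)
  (hSX_indep : independent_systems Q
    (g_sigma_algebra_preimage S) (sigma_of setT X))
  (bP : probability (massPartition R * cpath)%type R)
  (hbP : forall A, measurable A ->
    bP A = Q ((fun w => (S w, species_path (J (S w)) (X ^~ w))) @^-1` A))
  (G : massPartition R -> R)
  (hG : measurable_fun setT G)
  (hG_int : P.-integrable setT (EFin \o G)) :
  [/\ forall n, {ae bP, forall z,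
        posterior_mean bP G n z = cond_exp bP (B_ n) (fun z' => G z'.1) z},
      is_martingale bP (@B_ R) (posterior_mean bP G),
      {ae bP, forall z, posterior_mean bP G n z @[n --> \oo] --> G z.1},
      cvg_Lp bP 1 (posterior_mean bP G) (fun z => G z.1)
    & forall p : R, 1 < p -> (\int[P]_s (`|G s| `^ p)%:E < +oo)%E ->
        cvg_Lp bP p (posterior_mean bP G) (fun z => G z.1)].
Proof.
move=> /=; pose f (z : massPartition R * cpath) : R := G z.1.
have mG := integrable_measurable hG_int.
have If : bP.-integrable setT (EFin \o f) := integrable_mass hJ hS hbP hG_int.
have filB := B_filtration R; have [sB Bm leB] := filB.
pose M := posterior_mean bP G.
have HM n : is_cond_exp bP (g_sigma_algebra_preimage (pi_ n)) f (M n).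
  by apply: cond_expP => //; [exact: sigma_algebra_pi|exact: sub_pi_measurable].
have HMB n : is_cond_exp bP (B_ n) f (M n).
  exact: (is_cond_exp_B hJ hS hX_unif hX_indep hSX_indep hbP hG_int (HM n)).
have mM n : measurable_fun setT (M n).
  exact: integrable_measurable (cond_exp_integrable (HM n)).
have Mf : {ae bP, forall z, M n z @[n --> \oo] --> f z}.
  exact: (levy_cvg_mass hJ hS hX_unif hX_indep hSX_indep hbP hG_int HMB).
have Lp (p : R) : 1 <= p -> (\int[P]_s (`|G s| `^ p)%:E < +oo)%E
  -> cvg_Lp bP p M f.
  move=> p1 Ip; have p0 : 0 < p by rewrite (lt_le_trans ltr01).
  have IpE : (\int[bP]_z (`|f z| `^ p)%:E = \int[P]_s (`|G s| `^ p)%:E)%E.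
    apply: (ge0_integral_mass hJ hS hbP (h := fun s => (`|G s| `^ p)%:E)).
      exact: measurable_norm_powR.
    by move=> s; rewrite lee_fin powR_ge0.
  apply: cvg_Lp_of_ae_cvg => //.
  - exact: integrable_measurable If.
  - by rewrite IpE.
  move=> n.
  (* The partition into the values of [pi_ n], numbered by [pickle]. *)
  pose D k := [set z : massPartition R * cpath | pickle (pi_ n z :
    seq nat) = k].
  apply: (cond_exp_partition_Lp (D := D) p1 (sigma_algebra_pi R n)
    (@sub_pi_measurable R n) _ _ _ _ If (HM n)).
  - move=> k; exists [set c : composition | pickle (c : seq nat) = k] => //.
    by rewrite setTI.
  - by move=> k k' _ _ [z [<- <-]].
  - by apply/seteqP; split=> // z _; exists (pickle (pi_ n z : seq nat)).
  - move=> k z z' <- /(pcan_inj pickleK) zz'.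
    by apply: adapted_preimage_cst (cond_exp_adapted (HM n)) _; rewrite zz'.
split.
- move=> n; apply: (is_cond_exp_unique (sB n) (Bm n) If (HMB n)).
  exact: cond_expP.
- split=> // [n|n|m n mn].
  + exact: cond_exp_adapted (HMB n).
  + exact: cond_exp_integrable (HMB n).
  + have IM := cond_exp_integrable (HMB n).
    apply: (is_cond_exp_unique (sB m) (Bm m) IM); first exact: cond_expP.
    exact: is_cond_exp_tower (leB m n mn) (HMB n) (HMB m).
- exact: Mf.
- apply: Lp => //; under eq_integral do rewrite powRr1//.
  by have /integrableP[_] := hG_int.
- by move=> p /ltW; exact: Lp.
Qed.
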